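(* Let $1\le\nu<\infty$. The asymptotics of the iterates of bounded composition operators $C_\phi f=f\circ\phi$ on $\mathcal{F}^\nu$ are as follows. (1) If $\phi(z)=az$ with $|a|=1$ and $a\neq 1$, then the sequence $(C_\phi^n)_{n\ge1}$ consists of unitary operators, and it does not converge, even weakly. (2) If $\phi(z)=az+b$ with $|a|<1$ and $b\in\mathbb{C}$, then the sequence $(C_\phi^n)_{n\ge 1}$ converges in operator norm to the operator mapping each $f\in\mathcal{F}^\nu$ to the constant function with value $f(b/(1-a))$.
   Context: For $1\le\nu<\infty$, the Fock space $\mathcal{F}^\nu$ is the space of entire functions $f$ with $\|f\|_\nu:=\left(\frac{\nu}{2\pi}\int_{\mathbb{C}}|f(z)|^\nu e^{-\nu|z|^2/2}\,dm(z)\right)^{1/\nu}<\infty$ ($m$ = Lebesgue area measure). For an entire function $\phi$, $C_\phi f=f\circ\phi$. *)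

(* Defs.v *)
(* C is modelled as R[i] = complex R
   (mathcomp-real-closed) over an arbitrary R : realType; Lebesgue area
   measure on C is the product Lebesgue measure on R * R via (x,y) |-> x+iy. *)
From HB Require Import structures.
From mathcomp Require Import all_boot all_order all_algebra.
From mathcomp Require Import all_classical all_reals all_analysis.
From mathcomp Require Import complex.
Set Implicit Arguments.
Unset Strict Implicit.
Unset Printing Implicit Defensive.
Import Order.TTheory GRing.Theory Num.Theory.
Local Open Scope ring_scope.
Local Open Scope classical_set_scope.
Import numFieldNormedType.Exports.

Definition cabs {R : realType} (z : R[i]) : R := Normc.normc z.

Definition entire {R : realType} (f : R[i] -> R[i]) : Prop :=
  forall z0 : R[i], exists l : R[i], forall eps : R, 0 < eps ->
    exists2 delta : R, 0 < delta & forall z : R[i],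
      0 < cabs (z - z0) < delta ->
      cabs ((f z - f z0) / (z - z0) - l) < eps.

Definition cpt {R : realType} (p : R * R) : R[i] := Complex p.1 p.2.

Definition area {R : realType} :=
  ((@lebesgue_measure R) \x (@lebesgue_measure R))%E.

Definition fock_integral {R : realType} (nu : R) (f : R[i] -> R[i]) : \bar R :=
  (\int[@area R]_(p in setT)
     ((cabs (f (cpt p))) `^ nu * expR (- (nu * cabs (cpt p) ^+ 2) / 2))%:E)%E.

Definition in_fock {R : realType} (nu : R) (f : R[i] -> R[i]) : Prop :=
  entire f /\ (fock_integral nu f < +oo)%E.

(* the Fock norm ||f||_nu = (nu/(2 pi) int ...)^(1/nu)  (meaningful for f in F^nu) *)
Definition fock_norm {R : realType} (nu : R) (f : R[i] -> R[i]) : R :=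
  (nu / (2 * pi) * fine (fock_integral nu f)) `^ (nu^-1).

Definition comp_op {R : realType} (phi : R[i] -> R[i]) (f : R[i] -> R[i]) :
  R[i] -> R[i] := f \o phi.
Definition comp_op_iter {R : realType} (phi : R[i] -> R[i]) (n : nat) :
  (R[i] -> R[i]) -> (R[i] -> R[i]) := iter n (comp_op phi).

Definition fock_unitary {R : realType} (nu : R)
  (U : (R[i] -> R[i]) -> (R[i] -> R[i])) : Prop :=
  (forall f g (c : R[i]), in_fock nu f -> in_fock nu g ->
      U (fun z => c * f z + g z) = (fun z => c * U f z + U g z)) /\
  (forall f, in_fock nu f -> in_fock nu (U f)) /\
  (forall f, in_fock nu f -> fock_norm nu (U f) = fock_norm nu f) /\
  (forall g, in_fock nu g -> exists2 f, in_fock nu f & U f = g).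

Definition fock_bounded_op {R : realType} (nu : R)
  (T : (R[i] -> R[i]) -> (R[i] -> R[i])) : Prop :=
  (forall f g (c : R[i]), in_fock nu f -> in_fock nu g ->
      T (fun z => c * f z + g z) = (fun z => c * T f z + T g z)) /\
  (forall f, in_fock nu f -> in_fock nu (T f)) /\
  (exists M : R, forall f, in_fock nu f ->
      fock_norm nu (T f) <= M * fock_norm nu f).

Definition fock_functional {R : realType} (nu : R)
  (L : (R[i] -> R[i]) -> R[i]) : Prop :=
  (forall f g (c : R[i]), in_fock nu f -> in_fock nu g ->
      L (fun z => c * f z + g z) = c * L f + L g) /\
  (exists M : R, forall f, in_fock nu f -> cabs (L f) <= M * fock_norm nu f).

Definition fock_wot_cvg {R : realType} (nu : R)
  (A : nat -> (R[i] -> R[i]) -> (R[i] -> R[i]))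
  (T : (R[i] -> R[i]) -> (R[i] -> R[i])) : Prop :=
  forall f L, in_fock nu f -> fock_functional nu L ->
    (fun n => cabs (L (A n f) - L (T f))) @ \oo --> 0.

Definition fock_norm_cvg {R : realType} (nu : R)
  (A : nat -> (R[i] -> R[i]) -> (R[i] -> R[i]))
  (T : (R[i] -> R[i]) -> (R[i] -> R[i])) : Prop :=
  forall eps : R, 0 < eps -> exists N : nat, forall n : nat, (N <= n)%N ->
    forall f, in_fock nu f ->
      fock_norm nu (fun z => A n f z - T f z) <= eps * fock_norm nu f.

(* Main.v *)
(** Both parts rest on one estimate: f -> f w - f w' is bounded on F^nu, with
    norm at most a constant times |w - w'| exp((M + 2)^2 / 2) when |w|, |w'| are
    at most M.  It follows from the mean value identity
    [int Re f(z) k(z - w) dm(z) = Re f(w) int k dm] for the radial tent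
    [k(z) = max(0, 1 - |z|)], since k is bounded, Lipschitz and supported in the
    unit disc.  The identity is the average over the rotations about w of the
    mean value property on circles; the latter is Goursat's theorem applied on
    rectangles to the 2 pi i-periodic entire function [s -> f(z e^s + w)],
    followed by Re s -> -oo.

    For phi(z) = a z, the functional f -> f 1 - f 0 sends the n-th iterate of the
    identity function to a^n, which does not converge.  For |a| < 1, let p be the
    fixed point of phi: phi^n z - p = a^n (z - p), so f (phi^n z) - f p is at
    most |a|^n times |z - p| exp((|a| |z| + B)^2 / 2), whose nu-th power is
    integrable against exp(- nu |z|^2 / 2). *)
Require Import Defs.
From HB Require Import structures.
From mathcomp Require Import all_boot all_order all_algebra.
From mathcomp Require Import all_classical all_reals all_analysis.
From mathcomp Require Import measurable_realfun complex ring lra.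
Set Implicit Arguments.
Unset Strict Implicit.
Unset Printing Implicit Defensive.
Import Order.TTheory GRing.Theory Num.Theory.
Import numFieldNormedType.Exports.
Local Open Scope classical_set_scope.
Local Open Scope ring_scope.

(** * Translations, shears and rotations of the plane preserve area *)

Section area_preserving.
Context {R : realType}.
Local Open Scope ereal_scope.
Local Notation mu := (@lebesgue_measure R).

(** By uniqueness of Lebesgue measure it is enough to compare the two measures on half-open
    intervals. *)
Lemma lebesgue_measureD (t : R) (A : set R) : measurable A ->
  pushforward mu (fun x : measurableTypeR R => (x + t)%R : measurableTypeR R) A
  = mu A.
Proof.
pose phi (x : measurableTypeR R) : measurableTypeR R := (x + t)%R.
have mt : measurable_fun [set: measurableTypeR R] phi.
  exact: measurable_funD.
move=> mA; apply/esym.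
pose mtF := isMeasurableFun.Build _ _ _ _ _ mt.
pose f : {mfun measurableTypeR R >-> measurableTypeR R} := HB.pack phi mtF.
apply: (@lebesgue_measure_unique R (pushforward mu f)) => //= _ [[a b]] _ <-.
rewrite /pushforward.
rewrite (_ : _ @^-1` _ = [set` `]a - t, b - t]%R]); last first.
  by apply/seteqP; split => x /=; rewrite !in_itv/= ltrBlDr lerBrDr.
rewrite !lebesgue_measure_itv/= !lte_fin.
rewrite ltrD2r; case: ifPn => //; rewrite -!EFinB => _; congr EFin.
by rewrite opprB addrA subrK.
Qed.

Lemma ge0_integralT_shift (t : R) (f : R -> \bar R) :
  measurable_fun [set: R] f -> (forall x, 0 <= f x) ->
  \int[mu]_x f (x + t)%R = \int[mu]_x f x.
Proof.
move=> mf f0.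
have mt : measurable_fun [set: measurableTypeR R]
    (fun x : measurableTypeR R => (x + t)%R : measurableTypeR R).
  exact: measurable_funD.
have := @ge0_integral_pushforward _ _ _ _ R _ mt mu setT f measurableT mf
  (fun x _ => f0 x).
rewrite preimage_setT /comp => <-.
apply: eq_measure_integral => A mA _; exact: lebesgue_measureD.
Qed.

(** Phrased through integrals of nonnegative functions and not through measures of sets: this form
    composes at once, and Tonelli yields it directly for shears. *)
Definition area_preserving (rho : R * R -> R * R) :=
  measurable_fun setT rho /\
  forall F : R * R -> \bar R, measurable_fun setT F -> (forall p, 0 <= F p) ->
  \int[@area R]_p F (rho p) = \int[@area R]_p F p.

Lemma area_preserving_comp rho sigma : area_preserving rho ->
  area_preserving sigma -> area_preserving (rho \o sigma).
Proof.
move=> [mr r] [ms s]; split; first exact: measurableT_comp.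
move=> F mF F0; rewrite -(r F)//; apply: (s (F \o rho)) => [|p]; last exact: F0.
exact: measurableT_comp.
Qed.

(** Tonelli with the first coordinate innermost: on each horizontal line the shear is a
    translation. *)
Lemma area_preserving_shear1 (tau : R -> R) : measurable_fun setT tau ->
  area_preserving (fun p => (p.1 + tau p.2, p.2)%R).
Proof.
move=> mtau.
have mr : measurable_fun setT (fun p : R * R => (p.1 + tau p.2, p.2)%R).
  apply: measurable_fun_pair => //=; apply: measurable_funD => //=.
  exact: measurableT_comp.
split => // F mF F0; rewrite /area fubini_tonelli2//; last first.
  exact: measurableT_comp mF mr.
rewrite fubini_tonelli2//.
apply: eq_integral => y _ /=; rewrite /fubini_G /=.
apply: (ge0_integralT_shift (tau y) (f := fun x => F (x, y))) => //.
exact: measurableT_comp.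
Qed.

Lemma area_preserving_shear2 (tau : R -> R) : measurable_fun setT tau ->
  area_preserving (fun p => (p.1, p.2 + tau p.1)%R).
Proof.
move=> mtau.
have mr : measurable_fun setT (fun p : R * R => (p.1, p.2 + tau p.1)%R).
  apply: measurable_fun_pair => //=; apply: measurable_funD => //=.
  exact: measurableT_comp.
split => // F mF F0; rewrite /area fubini_tonelli1//; last first.
  exact: measurableT_comp mF mr.
rewrite fubini_tonelli1//.
apply: eq_integral => x _ /=; rewrite /fubini_F /=.
apply: (ge0_integralT_shift (tau x) (f := fun y => F (x, y))) => //.
exact: measurableT_comp.
Qed.

Lemma area_preserving_translation (w : R * R) :
  area_preserving (fun p => (w.1 + p.1, w.2 + p.2)%R).
Proof.
have := area_preserving_comp
  (area_preserving_shear2 (measurable_cst w.2 : measurable_fun setT _))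
  (area_preserving_shear1 (measurable_cst w.1 : measurable_fun setT _)).
by congr area_preserving; apply/funext => -[x y] /=;
  rewrite [(x + _)%R]addrC [(y + _)%R]addrC.
Qed.

(* A rotation of angle t <> pi is the product of three shears, the outer two
   with slope - tan (t / 2) = - s / (1 + c). *)
Lemma area_preserving_rotation (c s : R) : (c ^+ 2 + s ^+ 2 = 1)%R ->
  area_preserving (fun p => (c * p.1 - s * p.2, s * p.1 + c * p.2)%R).
Proof.
have main (c' s' : R) : (c' ^+ 2 + s' ^+ 2 = 1)%R -> (1 + c' != 0)%R ->
    area_preserving (fun p => (c' * p.1 - s' * p.2, s' * p.1 + c' * p.2)%R).
  move=> cs c1; pose t := (s' / (1 + c'))%R.
  have m1 (k : R) : measurable_fun [set: R] (fun y : R => k * y)%R.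
    exact: measurable_funM.
  have tc : (t * (1 + c') = s')%R by rewrite mulfVK.
  have ts : (t * s' = 1 - c')%R.
    apply: (mulIf c1); rewrite mulrAC tc.
    by transitivity (1 - c' ^+ 2)%R; [rewrite -cs|]; ring.
  have := area_preserving_comp (area_preserving_shear1 (m1 (- t)%R))
    (area_preserving_comp (area_preserving_shear2 (m1 s'))
      (area_preserving_shear1 (m1 (- t)%R))).
  congr area_preserving; apply/funext => -[x y] /=; congr pair.
    have -> : (x + - t * y + - t * (y + s' * (x + - t * y)) =
      x - (t * s') * x - t * y *+ 2 + (t * s') * (t * y))%R by ring.
    by rewrite ts -[in RHS]tc; ring.
  have -> : (y + s' * (x + - t * y) = s' * x + y - (t * s') * y)%R by ring.
  by rewrite ts; ring.
(* If [1 + c = 0] the map is the half turn, which is the square of the quarter turn, and [main]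
   covers the latter. *)
move=> cs; have [c1|] := eqVneq (1 + c)%R 0%R; last exact: main.
have s0 : s = 0%R.
  have c1' : c = (-1)%R by rewrite -[c](addKr 1%R) c1 addr0.
  by apply/eqP; rewrite -sqrf_eq0; apply/eqP; move: cs; rewrite c1'; lra.
have {}c1 : c = (-1)%R by rewrite -[c](addKr 1%R) c1 addr0.
have i2 : (0 ^+ 2 + 1 ^+ 2 = 1 :> R)%R by rewrite expr0n expr1n add0r.
have i0 : (1 + 0 != 0 :> R)%R by rewrite addr0 oner_neq0.
have := area_preserving_comp (main _ _ i2 i0) (main _ _ i2 i0).
by congr area_preserving; apply/funext => -[x y] /=; rewrite s0 c1; congr pair;
  ring.
Qed.

(** The extension to signed functions treats the positive and negative parts separately. *)
Lemma area_preserving_integral rho (F : R * R -> \bar R) :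
  area_preserving rho -> measurable_fun setT F ->
  \int[@area R]_p F (rho p) = \int[@area R]_p F p.
Proof.
move=> [mr r] mF; rewrite integralE [RHS]integralE; congr (_ - _).
  rewrite -(r F^\+ (measurable_funepos mF) (fun p => funepos_ge0 F p)).
  by apply: eq_integral => p _; rewrite !funeposE.
rewrite -(r F^\- (measurable_funeneg mF) (fun p => funeneg_ge0 F p)).
by apply: eq_integral => p _; rewrite !funenegE.
Qed.

End area_preserving.

(** * Elementary properties of the modulus *)

Section complex_modulus.
Context {R : realType}.
Implicit Types (z w : R[i]) (x y : R).

Lemma cabsE x y : cabs (Complex x y) = Num.sqrt (x ^+ 2 + y ^+ 2).
Proof. by []. Qed.

Lemma sqr_cabs x y : cabs (Complex x y) ^+ 2 = x ^+ 2 + y ^+ 2.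
Proof. by rewrite cabsE sqr_sqrtr// addr_ge0// sqr_ge0. Qed.

Lemma cabs_ge0 z : 0 <= cabs z.
Proof. by case: z => x y; rewrite cabsE sqrtr_ge0. Qed.

Lemma cabsM z w : cabs (z * w) = cabs z * cabs w.
Proof. exact: Normc.normcM. Qed.

Lemma cabsV z : cabs z^-1 = (cabs z)^-1.
Proof. exact: Normc.normcV. Qed.

Lemma cabs0 : cabs (0 : R[i]) = 0.
Proof. exact: Normc.normc0. Qed.

Lemma cabs1 : cabs (1 : R[i]) = 1.
Proof. exact: Normc.normc1. Qed.

Lemma cabsX z n : cabs (z ^+ n) = cabs z ^+ n.
Proof. by elim: n => [|n ih]; rewrite ?expr0 ?cabs1// !exprS cabsM ih. Qed.

Lemma cabsN z : cabs (- z) = cabs z.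
Proof. exact: normcN. Qed.

Lemma cabs_distC z w : cabs (z - w) = cabs (w - z).
Proof. by rewrite -cabsN opprB. Qed.

Lemma cabsD z w : cabs (z + w) <= cabs z + cabs w.
Proof. exact: le_normcD. Qed.

Lemma cabsB z w : cabs (z - w) <= cabs z + cabs w.
Proof. by rewrite -[cabs w]cabsN cabsD. Qed.

Lemma cabs_eq0 z : (cabs z == 0) = (z == 0).
Proof.
by apply/eqP/eqP => [|->]; [exact: Normc.eq0_normc|exact: cabs0].
Qed.

Lemma cabs_gt0 z : (0 < cabs z) = (z != 0).
Proof. by rewrite lt_neqAle cabs_ge0 andbT eq_sym cabs_eq0. Qed.

Lemma normr_Re_le z : `|complex.Re z| <= cabs z.
Proof.
case: z => x y; rewrite cabsE -sqrtr_sqr ler_sqrt ?lerDl ?sqr_ge0//.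
by rewrite addr_ge0// sqr_ge0.
Qed.

Lemma normr_Im_le z : `|complex.Im z| <= cabs z.
Proof.
case: z => x y; rewrite cabsE -sqrtr_sqr ler_sqrt ?lerDr ?sqr_ge0//.
by rewrite addr_ge0// sqr_ge0.
Qed.

Lemma cabs_le_ReIm z : cabs z <= `|complex.Re z| + `|complex.Im z|.
Proof.
case: z => x y /=; rewrite -(@ler_pXn2r _ 2) ?nnegrE ?cabs_ge0 ?addr_ge0//.
rewrite sqr_cabs sqrrD !real_normK ?num_real// addrAC lerDl.
by rewrite mulrn_wge0// mulr_ge0.
Qed.

End complex_modulus.

(** * Complex differentiability, composition and the exponential *)

Section entire_functions.
Context {R : realType}.
Implicit Types (f g : R[i] -> R[i]) (z w c : R[i]).

(** A form without division, in which [z = z0] is no exception; this makes the chain rule and the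
    rectangle estimates direct. *)
Lemma entireP f : entire f <-> forall z0, exists l : R[i], forall eps : R,
  0 < eps -> exists2 delta : R, 0 < delta & forall z, cabs (z - z0) < delta ->
  cabs (f z - f z0 - l * (z - z0)) <= eps * cabs (z - z0).
Proof.
have quot z z0 l : z != z0 -> cabs (f z - f z0 - l * (z - z0)) =
    cabs ((f z - f z0) / (z - z0) - l) * cabs (z - z0).
  by move=> zz0; rewrite -cabsM mulrBl divfK// subr_eq0.
split=> ef z0; have [l lP] := ef z0; exists l => eps eps0.
  have [d d0 dP] := lP eps eps0; exists d => // z zd.
  have [->|zz0] := eqVneq z z0; first by rewrite !subrr mulr0 subr0 cabs0 mulr0.
  rewrite quot// ler_wpM2r ?cabs_ge0// ltW// dP//.
  by rewrite zd andbT cabs_gt0 subr_eq0.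
(* Halving [eps] turns the weak inequality into the strict one required. *)
have [d d0 dP] := lP (eps / 2) (divr_gt0 eps0 (ltr0Sn _ 1)).
exists d => // z /andP[z0z zd]; have := dP z zd.
have zz0 : z != z0 by rewrite -subr_eq0 -cabs_gt0.
rewrite quot// ler_pM2r// => /le_lt_trans; apply.
by rewrite ltr_pdivrMr// ltr_pMr// ltrDl.
Qed.

Lemma entire_continuous f : entire f -> forall z0 (eps : R), 0 < eps ->
  exists2 delta : R, 0 < delta &
    forall z, cabs (z - z0) < delta -> cabs (f z - f z0) < eps.
Proof.
move=> /entireP ef z0 eps eps0; have [l /(_ 1 ltr01)[d d0 dP]] := ef z0.
have l1 : 0 < cabs l + 1 by rewrite ltr_wpDl ?cabs_ge0.
exists (Num.min d (eps / (cabs l + 1))); first by rewrite lt_min d0 divr_gt0.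
move=> z; rewrite lt_min => /andP[zd ze].
have -> : f z - f z0 = (f z - f z0 - l * (z - z0)) + l * (z - z0) by ring.
apply: le_lt_trans (cabsD _ _) _.
apply: le_lt_trans (lerD (dP z zd) (lexx _)) _.
by rewrite cabsM -mulrDl addrC mulrC -ltr_pdivlMr.
Qed.

Lemma entire_comp f g : entire f -> entire g -> entire (f \o g).
Proof.
move=> /entireP ef /entireP eg; apply/entireP => z0.
have [l lP] := eg z0; have [m mP] := ef (g z0); exists (m * l) => eps eps0.
have l1 : 0 < cabs l + 1 by rewrite ltr_wpDl ?cabs_ge0.
have m1 : 0 < cabs m + 1 by rewrite ltr_wpDl ?cabs_ge0.
(* [e1] compensates the local Lipschitz factor [cabs l + 1] of [g], and [e2] the factor [cabs m].
   The cap of [e2] at 1 is what provides that Lipschitz factor. *)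
pose e1 := eps / 2 / (cabs l + 1); pose e2 := Num.min 1 (eps / 2 / (cabs m + 1)).
have e10 : 0 < e1 by rewrite !divr_gt0.
have e20 : 0 < e2 by rewrite lt_min ltr01 !divr_gt0.
have [d1 d10 d1P] := mP e1 e10; have [d2 d20 d2P] := lP e2 e20.
exists (Num.min d2 (d1 / (cabs l + 1))); first by rewrite lt_min d20 divr_gt0.
move=> z; rewrite lt_min => /andP[zd2 zd1].
have gzz0 : cabs (g z - g z0) <= (cabs l + 1) * cabs (z - z0).
  have -> : g z - g z0 = (g z - g z0 - l * (z - z0)) + l * (z - z0) by ring.
  apply: le_trans (cabsD _ _) _.
  rewrite cabsM mulrDl mul1r addrC lerD2l; apply: le_trans (d2P z zd2) _.
  by rewrite ler_piMl ?cabs_ge0// ge_min lexx.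
have gd1 : cabs (g z - g z0) < d1.
  by apply: le_lt_trans gzz0 _; rewrite mulrC -ltr_pdivlMr.
have -> : (f \o g) z - (f \o g) z0 - m * l * (z - z0) =
  (f (g z) - f (g z0) - m * (g z - g z0)) + m * (g z - g z0 - l * (z - z0)).
  by rewrite /=; ring.
apply: le_trans (cabsD _ _) _; rewrite [eps]splitr mulrDl; apply: lerD.
  apply: le_trans (d1P _ gd1) _.
  apply: le_trans (ler_wpM2l (ltW e10) gzz0) _.
  by rewrite mulrA /e1 divfK// gt_eqF.
rewrite cabsM; apply: le_trans (ler_wpM2l (cabs_ge0 _) (d2P z zd2)) _.
rewrite mulrA ler_wpM2r ?cabs_ge0//.
apply: (@le_trans _ _ ((cabs m + 1) * (eps / 2 / (cabs m + 1)))).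
  apply: ler_pM; rewrite ?cabs_ge0 ?(ltW e20)//; first by rewrite lerDl.
  by rewrite ge_min lexx orbT.
by rewrite mulrC divfK// gt_eqF.
Qed.

Lemma entire_affine c w : entire (fun z => c * z + w).
Proof.
apply/entireP => z0; exists c => eps eps0; exists 1 => // z _.
by rewrite (_ : _ - _ = 0); [rewrite cabs0 mulr_ge0 ?cabs_ge0// ltW|ring].
Qed.

Lemma entire_shift w : entire (fun z => z + w).
Proof.
rewrite (_ : (fun z => z + w) = (fun z => 1 * z + w)); first exact: entire_affine.
by apply/funext => z; rewrite mul1r.
Qed.

Lemma is_derive_small_o (F : R -> R) (x d : R) : is_derive x 1 F d ->
  forall eps : R, 0 < eps -> exists2 delta : R, 0 < delta &
  forall h, `|h| < delta -> `|F (x + h) - F x - d * h| <= eps * `|h|.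
Proof.
move=> [dF dFE] eps eps0.
have : h^-1 *: (F (h *: 1 + x) - F x) @[h --> 0^'] --> d.
  by rewrite -dFE; exact: dF.
move/cvgrPdist_lt => /(_ _ eps0) [r /= r0 rP]; exists r => // h hr.
have [->|h0] := eqVneq h 0; first by rewrite addr0 !subrr mulr0 subr0 normr0 mulr0.
have := rP h; rewrite /= sub0r normrN => /(_ hr h0) /ltW.
rewrite distrC => H.
have -> : F (x + h) - F x - d * h =
    (h^-1 *: (F (h *: 1 + x) - F x) - d) * h.
  rewrite /GRing.scale /= mulr1 [h + x]addrC; field; exact: h0.
by rewrite normrM ler_wpM2r.
Qed.

Definition cexp z : R[i] :=
  Complex (expR (complex.Re z) * cos (complex.Im z))
          (expR (complex.Re z) * sin (complex.Im z)).

Lemma cexpD z w : cexp (z + w) = cexp z * cexp w.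
Proof.
case: z w => [a b] [c d]; rewrite /cexp /=.
rewrite expRD cosD sinD.
by apply/eqP; rewrite eq_complex /=; apply/andP; split; apply/eqP; ring.
Qed.

Lemma cabs_cexp z : cabs (cexp z) = expR (complex.Re z).
Proof.
rewrite /cexp cabsE !exprMn -mulrDr cos2Dsin2 mulr1 sqrtr_sqr.
by rewrite ger0_norm ?expR_ge0.
Qed.

(** By the functional equation only the derivative at 0 has to be found, and it comes from the
    first-order expansions of [expR], [cos] and [sin] at 0. *)
Lemma entire_cexp : entire cexp.
Proof.
have small eps : 0 < eps -> exists2 delta : R, 0 < delta & forall h,
    cabs h < delta -> cabs (cexp h - 1 - h) <= eps * cabs h.
  (* The error is at most [4 * e * r] in the real part and [5 * e * r] in the imaginary part, whence
     9. *)
  move=> eps0; pose e := Num.min 1 (eps / 9).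
  have e0 : 0 < e by rewrite lt_min ltr01 divr_gt0.
  have e1 : e <= 1 by rewrite ge_min lexx.
  have e9 : 9 * e <= eps by rewrite mulrC -ler_pdivlMr// ge_min lexx orbT.
  have [d1 d10 d1P] := is_derive_small_o (is_derive_expR 0) e0.
  have [d2 d20 d2P] := is_derive_small_o (is_derive_cos 0) e0.
  have [d3 d30 d3P] := is_derive_small_o (is_derive_sin 0) e0.
  exists (Num.min e (Num.min d1 (Num.min d2 d3))); first by rewrite lt_min e0 !lt_min d10 d20.
  move=> h; rewrite lt_min [_ < Num.min d1 _]lt_min [_ < Num.min d2 _]lt_min => /and4P[he hd1 hd2 hd3].
  have hx := normr_Re_le h; have hy := normr_Im_le h.
  have h0 := cabs_ge0 h.
  move: h0 he hd1 hd2 hd3 hx hy; case: h => x y.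
  set r := cabs (Complex x y) => r0 re rd1 rd2 rd3 xr yr.
  rewrite /= in xr yr.
  apply: le_trans (cabs_le_ReIm _) _; rewrite /= oppr0.
  have := d1P x (le_lt_trans xr rd1); have := d2P y (le_lt_trans yr rd2).
  have := d3P y (le_lt_trans yr rd3).
  rewrite !add0r expR0 sin0 cos0 oppr0 mul0r !subr0 addr0 !mul1r => H3 H2 H1.
  have er : 0 <= e * r by rewrite mulr_ge0// ltW.
  have {}H1 : `|expR x - 1 - x| <= e * r.
    by apply: le_trans H1 _; rewrite ler_wpM2l// ltW.
  have {}H2 : `|cos y - 1| <= e * r.
    by apply: le_trans H2 _; rewrite ler_wpM2l// ltW.
  have {}H3 : `|sin y - y| <= e * r.
    by apply: le_trans H3 _; rewrite ler_wpM2l// ltW.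
  have r1 : r <= 1 by rewrite (le_trans (ltW re)).
  have err : e * r <= r by rewrite ler_piMl.
  have ex1 : `|expR x - 1| <= 2 * r.
    rewrite (_ : expR x - 1 = (expR x - 1 - x) + x); last by ring.
    apply: le_trans (ler_normD _ _) _; lra.
  have ex3 : `|expR x| <= 3.
    rewrite (_ : expR x = (expR x - 1) + 1); last by ring.
    apply: le_trans (ler_normD _ _) _; rewrite normr1; lra.
  have -> : expR x * cos y - 1 - x = expR x * (cos y - 1) + (expR x - 1 - x) by ring.
  have -> : expR x * sin y + 0 - y = expR x * (sin y - y) + (expR x - 1) * y by ring.
  have A1 : `|expR x * (cos y - 1)| <= 3 * (e * r) by rewrite normrM ler_pM.
  have A2 : `|expR x * (sin y - y)| <= 3 * (e * r) by rewrite normrM ler_pM.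
  have A3 : `|(expR x - 1) * y| <= 2 * (e * r).
    rewrite normrM (le_trans (ler_pM _ _ ex1 yr))// mulrA -mulrA.
    by rewrite -mulrA ler_pM2l// ler_wpM2r// ltW.
  apply: (@le_trans _ _ (9 * e * r)); last by rewrite ler_wpM2r.
  have B1 := ler_normD (expR x * (cos y - 1)) (expR x - 1 - x).
  have B2 := ler_normD (expR x * (sin y - y)) ((expR x - 1) * y).
  rewrite -mulrA; lra.
apply/entireP => z0; exists (cexp z0) => eps eps0.
have c0 : 0 < cabs (cexp z0) by rewrite cabs_cexp expR_gt0.
have [d d0 dP] := small (eps / cabs (cexp z0)) (divr_gt0 eps0 c0).
exists d => // z zd; have := dP _ zd.
have -> : cexp z - cexp z0 - cexp z0 * (z - z0) =
    cexp z0 * (cexp (z - z0) - 1 - (z - z0)).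
  have -> : cexp z = cexp z0 * cexp (z - z0) by rewrite -cexpD addrC subrK.
  by ring.
by rewrite cabsM mulrAC ler_pdivlMr// mulrC.
Qed.

End entire_functions.

(** * Integrals of continuous functions over segments *)

Section interval_integral.
Context {R : realType}.
Local Notation mu := (@lebesgue_measure R).
Implicit Types (phi psi : R -> R) (a b c e : R).

Lemma continuous_itv_integrable phi a b : continuous phi ->
  mu.-integrable `[a, b] (EFin \o phi).
Proof.
move=> cphi; apply: continuous_compact_integrable; first exact: segment_compact.
exact: continuous_subspaceT.
Qed.

Lemma Rintegral_itv_split phi a b c : continuous phi -> a <= c -> c <= b ->
  \int[mu]_(x in `[a, b]) phi x =
  \int[mu]_(x in `[a, c]) phi x + \int[mu]_(x in `[c, b]) phi x.
Proof.
move=> cphi ac cb; have ib := continuous_itv_integrable a b cphi.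
have := @Rintegral_itvB R phi (BLeft a) (BRight b) c ib.
rewrite !bnd_simp => /(_ ac cb).
rewrite Rintegral_itv_obnd_cbnd; last first.
  apply: integrableS ib => //; apply: subset_itvr.
  by rewrite bnd_simp.
by move=> <-; rewrite addrC subrK.
Qed.

Lemma Rintegral_itvBfun phi psi a b : continuous phi -> continuous psi ->
  \int[mu]_(x in `[a, b]) (phi x - psi x) =
  \int[mu]_(x in `[a, b]) phi x - \int[mu]_(x in `[a, b]) psi x.
Proof. by move=> cphi cpsi; rewrite RintegralB//; exact: continuous_itv_integrable. Qed.

Lemma Rintegral_itv_near phi a b c e : continuous phi -> a <= b ->
  (forall x, a <= x <= b -> `|phi x - c| <= e) ->
  `|\int[mu]_(x in `[a, b]) phi x - c * (b - a)| <= e * (b - a).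
Proof.
move=> cphi ab H.
have J k : \int[mu]_(x in `[a, b]) (cst k x) = k * (b - a).
  rewrite Rintegral_cst//= lebesgue_measure_itv/= lte_fin; case: ltP => //= ba.
  by rewrite (le_anti (introT andP (conj ab ba))) subrr.
have ic k : mu.-integrable `[a, b] (EFin \o cst k).
  by apply: continuous_itv_integrable => x; exact: cvg_cst.
have ip := continuous_itv_integrable a b cphi.
rewrite ler_distl -mulrBl -mulrDl -!J; apply/andP; split.
  apply: le_Rintegral => //= x; rewrite in_itv/= => /H.
  by rewrite ler_distl => /andP[].
apply: le_Rintegral => //= x; rewrite in_itv/= => /H.
by rewrite ler_distl => /andP[].
Qed.

End interval_integral.

(** * Goursat's theorem on rectangles, imaginary part *)

Section goursat.
Context {R : realType}.
Local Notation mu := (@lebesgue_measure R).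
Variable g : R[i] -> R[i].
Hypothesis eg : entire g.

Definition Re_at (x y : R) := complex.Re (g (Complex x y)).
Definition Im_at (x y : R) := complex.Im (g (Complex x y)).
Local Notation u := Re_at.
Local Notation v := Im_at.

Lemma cabs_vert (x y y' : R) : cabs (Complex x y - Complex x y') = `|y - y'|.
Proof. by rewrite /= subrr expr0n add0r sqrtr_sqr. Qed.

Lemma cabs_horiz (x x' y : R) : cabs (Complex x y - Complex x' y) = `|x - x'|.
Proof. by rewrite /= subrr expr0n addr0 sqrtr_sqr. Qed.

(** Here [w] stands for the real or imaginary part, and [P] for an isometric parametrisation of a
    vertical or horizontal line. *)
Lemma entire_comp_continuous (w : R[i] -> R) : (forall z, `|w z| <= cabs z) ->
  forall (P : R -> R[i]) x, (forall y, cabs (P y - P x) = `|y - x|) ->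
  (forall z z', w (z - z') = w z - w z') ->
  {for x, continuous (fun y => w (g (P y)))}.
Proof.
move=> wle P x Px wB; apply/cvgrPdist_lt => eps eps0.
have [d d0 dP] := entire_continuous eg (P x) eps0.
exists d => //= y yd; rewrite -wB.
by rewrite (le_lt_trans (wle _))// cabs_distC dP// Px distrC.
Qed.

Lemma ReB (z z' : R[i]) : complex.Re (z - z') = complex.Re z - complex.Re z'.
Proof. by case: z z' => [? ?] []. Qed.
Lemma ImB (z z' : R[i]) : complex.Im (z - z') = complex.Im z - complex.Im z'.
Proof. by case: z z' => [? ?] []. Qed.

Lemma continuous_Re_at x : continuous (u x).
Proof.
by move=> y; apply: (entire_comp_continuous normr_Re_le (P := Complex x)) => [y'|];
  [exact: cabs_vert|exact: ReB].
Qed.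
Lemma continuous_Im_at y : continuous (v ^~ y).
Proof.
move=> x; apply: (entire_comp_continuous normr_Im_le (P := fun x => Complex x y)) => [x'|];
  [exact: cabs_horiz|exact: ImB].
Qed.

Lemma continuous_Re_atB x x' : continuous (fun y => u x y - u x' y).
Proof. by move=> y; apply: cvgB; exact: continuous_Re_at. Qed.
Lemma continuous_Im_atB y y' : continuous (fun x => v x y - v x y').
Proof. by move=> x; apply: cvgB; exact: continuous_Im_at. Qed.

(* The imaginary part of the integral of g along the boundary of
   [x0, x1] x [y0, y1]. *)
Definition rect_integral (x0 x1 y0 y1 : R) : R :=
  \int[mu]_(y in `[y0, y1]) (u x1 y - u x0 y) -
  \int[mu]_(x in `[x0, x1]) (v x y1 - v x y0).

Local Notation D := rect_integral.

Lemma rect_integral_splitx x0 m x1 y0 y1 : x0 <= m -> m <= x1 ->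
  D x0 x1 y0 y1 = D x0 m y0 y1 + D m x1 y0 y1.
Proof.
move=> xm mx; rewrite /rect_integral (Rintegral_itv_split (@continuous_Im_atB y1 y0) xm mx).
rewrite !Rintegral_itvBfun//; try exact: continuous_Re_at; try exact: continuous_Im_at.
ring.
Qed.

Lemma rect_integral_splity x0 x1 y0 m y1 : y0 <= m -> m <= y1 ->
  D x0 x1 y0 y1 = D x0 x1 y0 m + D x0 x1 m y1.
Proof.
move=> ym my; rewrite /rect_integral (Rintegral_itv_split (@continuous_Re_atB x1 x0) ym my).
rewrite !Rintegral_itvBfun//; try exact: continuous_Re_at; try exact: continuous_Im_at.
ring.
Qed.

(** Near [(xs, ys)] the function is affine with slope [l] up to [eps] times the distance. For the
    affine part both integrals equal [Re l * h * k] and cancel; only the error remains, integrated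
    over sides of total length [h + k]. *)
Lemma rect_integral_local (xs ys eps : R) : 0 < eps -> exists2 delta : R, 0 < delta &
  forall x y h k, x <= xs <= x + h -> y <= ys <= y + k -> h + k < delta ->
  `|D x (x + h) y (y + k)| <= 2 * eps * (h + k) ^+ 2.
Proof.
move=> eps0; have /entireP eg' := eg.
have [l /(_ eps eps0)[d d0 dP]] := eg' (Complex xs ys).
exists d => // x y h k /andP[xx xh] /andP[yy yk] hk.
have h0 : 0 <= h by rewrite -(lerD2l x) addr0 (le_trans xx).
have k0 : 0 <= k by rewrite -(lerD2l y) addr0 (le_trans yy).
set s := h + k.
have near_s a b : x <= a <= x + h -> y <= b <= y + k ->
    cabs (Complex a b - Complex xs ys) <= s.
  move=> /andP[xa ah] /andP[yb bk]; apply: le_trans (cabs_le_ReIm _) _ => /=.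
  by rewrite lerD// ler_distl; apply/andP; split; lra.
have approx a b : x <= a <= x + h -> y <= b <= y + k ->
    cabs (g (Complex a b) - g (Complex xs ys)
          - l * (Complex a b - Complex xs ys)) <= eps * s.
  move=> xa yb; have ns := near_s _ _ xa yb.
  apply: le_trans (dP _ (le_lt_trans ns hk)) _.
  by rewrite ler_wpM2l// ltW.
have diff a b a' b' : x <= a <= x + h -> y <= b <= y + k ->
    x <= a' <= x + h -> y <= b' <= y + k ->
    cabs (g (Complex a' b') - g (Complex a b)
          - l * (Complex a' b' - Complex a b)) <= 2 * eps * s.
  move=> xa yb xa' yb'.
  have -> : g (Complex a' b') - g (Complex a b)
          - l * (Complex a' b' - Complex a b) =
      (g (Complex a' b') - g (Complex xs ys)
          - l * (Complex a' b' - Complex xs ys)) -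
      (g (Complex a b) - g (Complex xs ys)
          - l * (Complex a b - Complex xs ys)) by ring.
  apply: le_trans (cabsB _ _) _.
  have := approx _ _ xa yb; have := approx _ _ xa' yb'; lra.
have Xl : x <= x <= x + h by rewrite lexx lerDl.
have Xr : x <= x + h <= x + h by rewrite lexx lerDl h0.
have Yl : y <= y <= y + k by rewrite lexx lerDl.
have Yr : y <= y + k <= y + k by rewrite lexx lerDl k0.
(* The affine part grows by [l * h] across the width and by [l * i * k] across the height; the real
   part of the former is [Re l * h], the imaginary part of the latter [Re l * k]. *)
have I1 : `|\int[mu]_(b in `[y, y + k]) (u (x + h) b - u x b)
            - complex.Re l * h * (y + k - y)| <= 2 * eps * s * (y + k - y).
  apply: Rintegral_itv_near; [exact: continuous_Re_atB|by rewrite lerDl|move=> b yb].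
  have := diff _ _ _ _ Xl yb Xr yb; apply: le_trans.
  apply: le_trans (normr_Re_le _); rewrite !ReB.
  case: (l) => l1 l2 /=; rewrite le_eqVlt; apply/orP; left; apply/eqP; congr `|_ - _|; ring.
have I2 : `|\int[mu]_(a in `[x, x + h]) (v a (y + k) - v a y)
            - complex.Re l * k * (x + h - x)| <= 2 * eps * s * (x + h - x).
  apply: Rintegral_itv_near; [exact: continuous_Im_atB|by rewrite lerDl|move=> a xa].
  have := diff _ _ _ _ xa Yl xa Yr; apply: le_trans.
  apply: le_trans (normr_Im_le _); rewrite !ImB.
  case: (l) => l1 l2 /=; rewrite le_eqVlt; apply/orP; left; apply/eqP; congr `|_ - _|; ring.
rewrite /rect_integral; move: I1 I2.
set A := \int[mu]_(_ in _) _; set B := \int[mu]_(_ in _) _.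
rewrite ![_ + _ - _]addrAC !subrr !add0r [complex.Re l * k * h]mulrAC.
set C := complex.Re l * h * k => I1 I2.
have -> : A - B = (A - C) - (B - C) by ring.
apply: le_trans (ler_normB _ _) _; apply: le_trans (lerD I1 I2) _.
by rewrite le_eqVlt; apply/orP; left; apply/eqP; rewrite /s; ring.
Qed.

(** Repeated quartering: were the boundary integral of modulus [eta > 0], some quarter would always
    retain a fourth of its parent's share, and the nested quarters would shrink to a point where
    [rect_integral_local] forbids this. *)
Lemma goursat (x0 y0 h k : R) : 0 <= h -> 0 <= k ->
  \int[mu]_(y in `[y0, y0 + k]) (u (x0 + h) y - u x0 y) =
  \int[mu]_(x in `[x0, x0 + h]) (v x (y0 + k) - v x y0).
Proof.
move=> h0 k0; apply/eqP; rewrite -subr_eq0 -/(D _ _ _ _) -normr_le0 leNgt.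
apply/negP; set eta := `|_| => eta0.
have p0 n : 0 < (2 ^+ n)^-1 :> R by rewrite invr_gt0 exprn_gt0.
(* A rectangle is coded by its generation [n] and its lower left corner; its sides are [h / 2 ^+ n]
   and [k / 2 ^+ n]. *)
pose bad (q : nat * (R * R)) := eta / 4 ^+ q.1 <=
  `|D q.2.1 (q.2.1 + h / 2 ^+ q.1) q.2.2 (q.2.2 + k / 2 ^+ q.1)|.
pose next (q q' : nat * (R * R)) := [/\ bad q', q'.1 = q.1.+1,
  q.2.1 <= q'.2.1 /\ q'.2.1 + h / 2 ^+ q.1.+1 <= q.2.1 + h / 2 ^+ q.1 &
  q.2.2 <= q'.2.2 /\ q'.2.2 + k / 2 ^+ q.1.+1 <= q.2.2 + k / 2 ^+ q.1].
have step (q : {q | bad q}) : exists q' : {q | bad q}, next (sval q) (sval q').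
  case: q => -[n [x y]] /= b.
  pose a := h / 2 ^+ n.+1; pose c := k / 2 ^+ n.+1.
  have a0 : 0 <= a by rewrite mulr_ge0// ltW.
  have c0 : 0 <= c by rewrite mulr_ge0// ltW.
  have ha : h / 2 ^+ n = a + a.
    by rewrite /a exprS invfM; field; rewrite expf_neq0.
  have kc : k / 2 ^+ n = c + c.
    by rewrite /c exprS invfM; field; rewrite expf_neq0.
  have choose x' y' : (x' = x \/ x' = x + a) -> (y' = y \/ y' = y + c) ->
      bad (n.+1, (x', y')) ->
      exists q' : {q | bad q}, next (n, (x, y)) (sval q').
    move=> xx yy b'; exists (exist (fun q => bad q) (n.+1, (x', y')) b'); split => //=; rewrite ?ha ?kc -/a -/c.
      by case: xx => ->; split; lra.
    by case: yy => ->; split; lra.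
  have {b} : eta / 4 ^+ n.+1 * 4 <= `|D x (x + (a + a)) y (y + (c + c))|.
    by rewrite exprS invfM mulrCA mulrAC mulVf// mul1r -ha -kc.
  rewrite !addrA (@rect_integral_splitx x (x + a)) ?lerDl//.
  rewrite (@rect_integral_splity x (x + a) y (y + c)) ?lerDl//.
  rewrite (@rect_integral_splity (x + a) (x + a + a) y (y + c)) ?lerDl// => big.
  have [b1|b1] := boolP (bad (n.+1, (x, y))); first by apply: choose b1; left.
  have [b2|b2] := boolP (bad (n.+1, (x, y + c))).
    by apply: choose b2; [left|right].
  have [b3|b3] := boolP (bad (n.+1, (x + a, y))).
    by apply: choose b3; [right|left].
  have [b4|b4] := boolP (bad (n.+1, (x + a, y + c))).
    by apply: choose b4; right.
  (* With all four quarters below their share, the triangle inequality contradicts the share of the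
     parent. *)
  move: b1 b2 b3 b4 big; rewrite /bad /= -/a -/c -!ltNge.
  move: (eta / 4 ^+ n.+1) => e b1 b2 b3 b4 big.
  exfalso.
  have := ler_normD (D x (x + a) y (y + c) + D x (x + a) (y + c) (y + c + c))
    (D (x + a) (x + a + a) y (y + c) + D (x + a) (x + a + a) (y + c) (y + c + c)).
  have := ler_normD (D x (x + a) y (y + c)) (D x (x + a) (y + c) (y + c + c)).
  have := ler_normD (D (x + a) (x + a + a) y (y + c))
    (D (x + a) (x + a + a) (y + c) (y + c + c)).
  lra.
have bad0 : bad (0%N, (x0, y0)).
  by rewrite /bad /= expr0 expr0 divr1 !divr1.
have [f fS] := choice step.
pose r n := sval (iter n f (exist (fun q => bad q) _ bad0)).
have r1 n : (r n).1 = n.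
  by elim: n => // n ih; have [_ + _ _] := fS (iter n f (exist (fun q => bad q) _ bad0)); rewrite -/(r n) ih.
have rbad n : bad (r n) by exact: (svalP (iter n f (exist (fun q => bad q) _ bad0))).
(* Nested intervals for one coordinate [w] of the corners: the supremum of the left ends lies in all
   of them. *)
have lim (w : R * R -> R) m : 0 <= m ->
  (forall n, w (r n).2 <= w (r n.+1).2 /\
    w (r n.+1).2 + m / 2 ^+ n.+1 <= w (r n).2 + m / 2 ^+ n) ->
  exists ws, forall n, w (r n).2 <= ws <= w (r n).2 + m / 2 ^+ n.
  move=> m0 H.
  have up n j : w (r n).2 <= w (r (n + j)%N).2.
    elim: j => [|j ih]; first by rewrite addn0.
    by rewrite addnS (le_trans ih)//; case: (H (n + j)%N).
  have dn n j : w (r (n + j)%N).2 + m / 2 ^+ (n + j) <= w (r n).2 + m / 2 ^+ n.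
    elim: j => [|j ih]; first by rewrite addn0.
    by rewrite addnS (le_trans _ ih)//; case: (H (n + j)%N).
  have le n j : w (r j).2 <= w (r n).2 + m / 2 ^+ n.
    apply: le_trans (dn n j); rewrite addnC.
    by apply: le_trans (up j n) _; rewrite lerDl mulr_ge0// ltW.
  exists (sup (range (fun n => w (r n).2))) => n; apply/andP; split.
    apply: ub_le_sup; last by exists n.
    by exists (w (r 0%N).2 + m / 2 ^+ 0) => _ [j _ <-].
  apply: ge_sup; first by exists (w (r 0%N).2); exists 0%N.
  by move=> _ [j _ <-].
have nxt n : next (r n) (r n.+1) by exact: fS.
have [xs xsP] : exists ws, forall n, (r n).2.1 <= ws <= (r n).2.1 + h / 2 ^+ n.
  by apply: (lim fst) => // n; have := nxt n; rewrite /next !r1 => -[].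
have [ys ysP] : exists ws, forall n, (r n).2.2 <= ws <= (r n).2.2 + k / 2 ^+ n.
  by apply: (lim snd) => // n; have := nxt n; rewrite /next !r1 => -[].
(* The added 1 keeps [s] positive for degenerate rectangles. [eps] is chosen so that the local bound
   at generation [n] is half of [eta / 4 ^+ n]. *)
pose s := h + k + 1; have s0 : 0 < s by rewrite ltr_wpDl// addr_ge0.
pose eps := eta / (4 * s ^+ 2).
have eps0 : 0 < eps by rewrite divr_gt0// mulr_gt0// exprn_gt0.
have [d d0 dP] := rect_integral_local xs ys eps0.
pose n := Num.bound (s / d).
have sd : s / 2 ^+ n < d.
  rewrite ltr_pdivrMr ?exprn_gt0// mulrC -ltr_pdivrMr//.
  apply: lt_le_trans (archi_boundP _) _; first by rewrite divr_ge0// ltW.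
  by rewrite -natrX ler_nat ltnW// ltn_expl.
have hks : h / 2 ^+ n + k / 2 ^+ n <= s / 2 ^+ n.
  by rewrite -mulrDl ler_pM2r// lerDl.
have := dP _ _ _ _ (xsP n) (ysP n) (le_lt_trans hks sd).
apply/negP; rewrite -ltNge; have := rbad n; rewrite /bad r1; apply: lt_le_trans.
apply: (@le_lt_trans _ _ (2 * eps * (s / 2 ^+ n) ^+ 2)).
  apply: ler_wpM2l; first by rewrite mulr_ge0// ltW.
  by apply: lerXn2r; rewrite ?nnegrE// ?addr_ge0// mulr_ge0// ltW.
have -> : 2 * eps * (s / 2 ^+ n) ^+ 2 = eta / 4 ^+ n / 2.
  rewrite /eps (_ : 4 ^+ n = (2 ^+ n) ^+ 2); last first.
    by rewrite -exprM mulnC exprM; congr (_ ^+ n); ring.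
  by field; rewrite expf_neq0// gt_eqF.
by rewrite ltr_pdivrMr// ltr_pMr ?ltrDl// divr_gt0// exprn_gt0.
Qed.

End goursat.

(** * The mean value property on circles *)

Section circle_mean.
Context {R : realType}.
Local Notation mu := (@lebesgue_measure R).

Lemma continuous_circle (f : R[i] -> R[i]) (z w : R[i]) : entire f ->
  continuous (fun t => complex.Re (f (z * Complex (cos t) (sin t) + w))).
Proof.
move=> ef; pose g s := f (z * cexp s + w).
have eg : entire g := entire_comp ef (entire_comp (entire_affine z w) (@entire_cexp R)).
rewrite (_ : (fun t => _) = Re_at g 0); first exact: continuous_Re_at.
by apply/funext => t; rewrite /Re_at /g /cexp /= expR0 !mul1r.
Qed.

Lemma circle_mean (f : R[i] -> R[i]) (z w : R[i]) : entire f ->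
  \int[mu]_(t in `[0, pi *+ 2])
    complex.Re (f (z * Complex (cos t) (sin t) + w)) = complex.Re (f w) * (pi *+ 2).
Proof.
move=> ef; pose g s := f (z * cexp s + w).
have eg : entire g := entire_comp ef (entire_comp (entire_affine z w) (@entire_cexp R)).
have p0 : 0 <= pi *+ 2 :> R by rewrite mulrn_wge0// pi_ge0.
have g0 t : complex.Re (f (z * Complex (cos t) (sin t) + w)) = Re_at g 0 t.
  by rewrite /Re_at /g /cexp /= expR0 !mul1r.
(* Goursat on [[- x, 0]] times [[0, 2 pi]]: the horizontal sides cancel by periodicity, so the
   vertical sides have equal integrals. *)
have invariant x : 0 <= x -> \int[mu]_(t in `[0, pi *+ 2]) Re_at g 0 t =
    \int[mu]_(t in `[0, pi *+ 2]) Re_at g (- x) t.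
  move=> x0; have := @goursat _ g eg (- x) 0 x (pi *+ 2) x0 p0.
  rewrite addNr add0r Rintegral_itvBfun; try exact: continuous_Re_at.
  rewrite (_ : (fun t => Im_at g t (pi *+ 2) - Im_at g t 0) = cst 0); last first.
    apply/funext => t; rewrite /Im_at /g /cexp /=.
    by rewrite -[pi *+ 2]add0r cosD2pi sinD2pi subrr.
  rewrite Rintegral_cst//= mul0r => /eqP; rewrite subr_eq0 => /eqP //.
under eq_Rintegral do rewrite g0.
apply/eqP; rewrite -subr_eq0 -normr_le0; apply/ler_addgt0Pr => eps eps0.
rewrite add0r; pose e := eps / (pi *+ 2).
have pp : 0 < pi *+ 2 :> R by rewrite mulrn_wgt0// pi_gt0.
have e0 : 0 < e by rewrite divr_gt0.
have [d d0 dP] := entire_continuous ef w e0.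
(* Since [expR x >= 1 + x > cabs z / d], the circle of radius [cabs z * expR (- x)] lies within [d]
   of its centre. *)
pose x := cabs z / d; have x0 : 0 <= x by rewrite divr_ge0 ?cabs_ge0// ltW.
rewrite (invariant x x0).
rewrite [leRHS](_ : eps = e * (pi *+ 2 - 0)); last first.
  by rewrite subr0 /e divfK// gt_eqF.
rewrite -[X in complex.Re _ * X]subr0.
apply: Rintegral_itv_near => [|//|t _]; first exact: continuous_Re_at.
rewrite /Re_at -ReB; apply: le_trans (normr_Re_le _) _; apply/ltW/dP.
rewrite addrK cabsM cabs_cexp /= expRN.
rewrite ltr_pdivrMr ?expR_gt0//.
apply: (@lt_le_trans _ _ (d * (1 + x))).
  by rewrite /x mulrDr mulr1 mulrC divfK ?gt_eqF// ltrDr.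
by rewrite ler_pM2l// expR_ge1Dx.
Qed.

End circle_mean.

(** * Measurability of continuous functions on the plane *)

Section planar_measurability.
Context {R : realType}.

(** The sigma-algebra of [R * R] is the product one, so each set [a < U p] is written as a countable
    union of open squares with rational centres and radii. *)
Lemma measurable_fun_planar_continuous (U : R * R -> R) :
  (forall p eps, 0 < eps -> exists2 delta, 0 < delta & forall q,
     `|q.1 - p.1| < delta -> `|q.2 - p.2| < delta -> `|U q - U p| < eps) ->
  measurable_fun setT U.
Proof.
move=> cU mT; apply: (measurability _ (RGenOInfty.measurableE R)) => //.
move=> _ [_ [a ->] <-]; rewrite setTI preimage_itvoy.
pose near_rat (q1 q2 e : rat) (p : R * R) :=
  `|p.1 - ratr q1| < ratr e /\ `|p.2 - ratr q2| < ratr e.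
rewrite (_ : [set p | a < U p] = \bigcup_(q1 : rat) \bigcup_(q2 : rat)
    \bigcup_(e : rat) [set p | near_rat q1 q2 e p /\
      forall p', near_rat q1 q2 e p' -> a < U p']); last first.
  apply/seteqP; split => [p /= ap|p [q1 _ [q2 _ [e _ [] pe]]]]; last exact.
  have ap0 : 0 < U p - a by rewrite subr_gt0.
  have [d d0 dP] := cU p _ ap0.
  (* With [e < d / 2], any two points of a square of radius [e] have coordinates less than [d]
     apart. *)
  have [e] := rat_in_itvoo (divr_gt0 d0 (ltr0Sn R 1)).
  rewrite in_itv/= => /andP[e0 ed].
  have [q1] : exists q : rat, ratr q \in `]p.1 - ratr e, p.1 + ratr e[.
    by apply: rat_in_itvoo; rewrite ltrBlDr -addrA ltrDl addr_gt0.
  rewrite in_itv/= -ltr_distl => pq1.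
  have [q2] : exists q : rat, ratr q \in `]p.2 - ratr e, p.2 + ratr e[.
    by apply: rat_in_itvoo; rewrite ltrBlDr -addrA ltrDl addr_gt0.
  rewrite in_itv/= -ltr_distl => pq2.
  exists q1 => //; exists q2 => //; exists e => //; split.
    by split; rewrite distrC.
  move=> p' [p'1 p'2].
  suff : `|U p' - U p| < U p - a by rewrite ltr_distl => /andP[]; lra.
  apply: dP.
    by move: p'1 pq1; rewrite !ltr_norml => /andP[? ?] /andP[? ?]; apply/andP; lra.
  by move: p'2 pq2; rewrite !ltr_norml => /andP[? ?] /andP[? ?]; apply/andP; lra.
apply: bigcupT_measurable_rat => q1; apply: bigcupT_measurable_rat => q2.
apply: bigcupT_measurable_rat => e.
have [H|H] := pselect (forall p', near_rat q1 q2 e p' -> a < U p'); last first.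
  by rewrite (_ : [set p | _] = set0)//; apply/seteqP; split => // p [].
rewrite (_ : [set p | _] = ball (ratr q1 : R) (ratr e) `*` ball (ratr q2 : R) (ratr e)).
  by apply: measurableX; exact: measurable_ball.
apply/seteqP; split => p; rewrite /= -!ball_normE /= /near_rat.
  by move=> [] [? ?] _; split; rewrite distrC.
by move=> [? ?]; split => //; split; rewrite distrC.
Qed.

Lemma cabs_cptB (p q : R * R) :
  cabs (cpt q - cpt p) <= `|q.1 - p.1| + `|q.2 - p.2|.
Proof. exact: cabs_le_ReIm. Qed.

Lemma entire_measurable_comp (f : R[i] -> R[i]) (w : R[i] -> R) : entire f ->
  (forall z z', `|w z - w z'| <= cabs (z - z')) ->
  measurable_fun setT (fun p : R * R => w (f (cpt p))).
Proof.
move=> ef wle; apply: measurable_fun_planar_continuous => p eps eps0.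
have [d d0 dP] := entire_continuous ef (cpt p) eps0.
exists (d / 2); first exact: divr_gt0.
move=> q q1 q2; apply: le_lt_trans (wle _ _) _; apply: dP.
apply: le_lt_trans (cabs_cptB _ _) _; lra.
Qed.

Lemma entire_measurable_Re (f : R[i] -> R[i]) : entire f ->
  measurable_fun setT (fun p : R * R => complex.Re (f (cpt p))).
Proof.
move=> ef; apply: entire_measurable_comp => // z z'; rewrite -ReB.
exact: normr_Re_le.
Qed.

Lemma dist_cabs_le (z z' : R[i]) : `|cabs z - cabs z'| <= cabs (z - z').
Proof.
have tri (a b : R[i]) : cabs a <= cabs (a - b) + cabs b.
  by rewrite -{1}(subrK b a) cabsD.
have := tri z z'; have := tri z' z; rewrite (cabs_distC z' z) ler_norml.
by move=> ? ?; apply/andP; split; lra.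
Qed.

Lemma entire_measurable_cabs (f : R[i] -> R[i]) : entire f ->
  measurable_fun setT (fun p : R * R => cabs (f (cpt p))).
Proof. by move=> ef; apply: entire_measurable_comp => // z z'; exact: dist_cabs_le. Qed.

End planar_measurability.

(** * Averaging an integral over a parameter *)

Section fubini_average.
Local Open Scope ereal_scope.
Context d1 d2 (T1 : measurableType d1) (T2 : measurableType d2) (R : realType).
Variable m1 : {sigma_finite_measure set T1 -> \bar R}.
Variable m2 : {sigma_finite_measure set T2 -> \bar R}.

(** The slices share the finite absolute integral [C] and [m1 D] is finite, so [G] extended by zero
    off [D] is integrable on the product and Fubini applies. *)
Lemma fubini_average (D : set T1) (G : T1 * T2 -> \bar R) (C I : \bar R) :
  measurable D -> m1 D < +oo -> measurable_fun setT G -> 0 <= C < +oo ->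
  (forall x, D x -> \int[m2]_y `|G (x, y)| = C) ->
  (forall x, D x -> \int[m2]_y G (x, y) = I) ->
  I * m1 D = \int[m2]_y \int[m1]_(x in D) G (x, y).
Proof.
move=> mD Dfin mG /andP[C0 Cfin] GC GI.
pose F := G \_ (D `*` setT).
have mF : measurable_fun setT F.
  by apply: (measurable_restrictT _ _).1; [exact: measurableX|exact: measurable_funTS].
have FE x y : F (x, y) = ((fun x => G (x, y)) \_ D) x.
  rewrite /F !patchE; congr (if _ then _ else _).
  by apply/idP/idP; rewrite !inE/=; [case|].
have FC : \int[m1]_x \int[m2]_y `|F (x, y)| = C * m1 D.
  rewrite -integral_cst// [RHS]integral_mkcond; apply: eq_integral => x _.
  rewrite patchE; case: ifPn => xD.
    rewrite /= -(GC x); last by move: xD; rewrite inE.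
    by apply: eq_integral => y _; rewrite FE patchE xD.
  rewrite -[RHS]/(0%E : \bar R) -(integral0 m2 setT); apply: eq_integral => y _.
  by rewrite FE patchE (negbTE xD) abse0.
have iF : (m1 \x m2).-integrable setT F.
  apply/(integrable12ltyP m1 m2 mF).
  by rewrite FC; apply: lte_mul_pinfty => //; rewrite ge0_fin_numE.
transitivity (\int[m1]_x \int[m2]_y F (x, y)).
  rewrite -integral_cst// [LHS]integral_mkcond; apply: eq_integral => x _.
  rewrite patchE; case: ifPn => xD.
    rewrite /= -(GI x); last by move: xD; rewrite inE.
    by apply: eq_integral => y _; rewrite FE patchE xD.
  rewrite -[LHS]/(0%E : \bar R) -(integral0 m2 setT); apply: eq_integral => y _.
  by rewrite FE patchE (negbTE xD).
rewrite (Fubini iF); apply: eq_integral => y _; rewrite [RHS]integral_mkcond.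
by apply: eq_integral => x _; rewrite FE.
Qed.

End fubini_average.

(** * Sigma-finiteness of area, and squares as substitutes for discs *)

Section area_measure.
Context {R : realType}.

(** Required for Fubini on the product of angle and area. The exhaustion of the line is
    nondecreasing, hence the products [F n] times [F n] already cover the plane. *)
Lemma area_sigma_finite : sigma_finite setT (@area R).
Proof.
have /sigma_finiteP[F [FT ndF Foo]] := sigma_finiteT (@lebesgue_measure R).
exists (fun n => F n `*` F n).
  apply/seteqP; split => // -[x y] _.
  have [i _ Fx] : (\bigcup_i F i) x by rewrite -FT.
  have [j _ Fy] : (\bigcup_i F i) y by rewrite -FT.
  exists (maxn i j) => //; split => /=.
    by move: x Fx; apply/subsetPset/ndF/leq_maxl.
  by move: y Fy; apply/subsetPset/ndF/leq_maxr.
move=> n; have [mF Fn] := Foo n; split; first exact: measurableX.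
by rewrite /area product_measure1E// lte_mul_pinfty// ge0_fin_numE.
Qed.

HB.instance Definition _ := Measure.on (@area R).
HB.instance Definition _ :=
  Measure_isSigmaFinite.Build _ _ _ (@area R) area_sigma_finite.

(** A square has its area as a product of two lengths; this one contains the disc of radius [r] and
    lies in the disc of radius [2 * r]. *)
Definition square (r : R) (w : R[i]) : set (R * R) :=
  `[complex.Re w - r, complex.Re w + r]%classic `*`
  `[complex.Im w - r, complex.Im w + r]%classic.

Lemma measurable_square r w : measurable (square r w).
Proof. by apply: measurableX; exact: measurable_itv. Qed.

Lemma area_square r w : 0 < r -> @area R (square r w) = ((2 * r) ^+ 2)%:E.
Proof.
move=> r0; rewrite /area product_measure1E; try exact: measurable_itv.
have lt (x : R) : x - r < x + r by lra.
rewrite [X in (X * _)%E]lebesgue_measure_itv [X in (_ * X)%E]lebesgue_measure_itv.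
by rewrite /= !lte_fin !lt -!EFinB -EFinM; congr EFin; ring.
Qed.

Lemma integral_square r w : 0 < r ->
  (\int[@area R]_p (\1_(square r w) p)%:E = ((2 * r) ^+ 2)%:E)%E.
Proof.
move=> r0; rewrite (@integral_indic _ _ R (@area R) setT measurableT).
  by rewrite setIT; exact: area_square.
exact: measurable_square.
Qed.

Lemma integrable_square r w : 0 < r ->
  (@area R).-integrable setT (fun p => (\1_(square r w) p)%:E).
Proof.
move=> r0; apply/integrableP; split.
  by apply/measurable_EFinP; apply: measurable_indic; exact: measurable_square.
under eq_integral do rewrite gee0_abs ?lee_fin//.
by rewrite integral_square// ltry.
Qed.

Lemma cabs_square r w p : cabs (cpt p - w) <= r -> square r w p.
Proof.
move=> pw; split => /=; rewrite in_itv/= -ler_distl.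
  by rewrite -[p.1]/(complex.Re (cpt p)) -ReB (le_trans (normr_Re_le _) pw).
by rewrite -[p.2]/(complex.Im (cpt p)) -ImB (le_trans (normr_Im_le _) pw).
Qed.

Lemma square_cabs r w p : square r w p -> cabs (cpt p - w) <= 2 * r.
Proof.
case => /=; rewrite !in_itv/= -!ler_distl => p1 p2.
apply: le_trans (cabs_le_ReIm _) _; rewrite ReB ImB mulr2n mulrDl mul1r.
exact: lerD.
Qed.

End area_measure.

(** * The mean value identity against the radial tent *)

Section tent.
Context {R : realType}.
Local Notation mu := (@lebesgue_measure R).

Definition tent (z : R[i]) : R := Num.max 0 (1 - cabs z).

Lemma tent_ge0 z : 0 <= tent z.
Proof. by rewrite le_max lexx. Qed.

Lemma tent_le1 z : tent z <= 1.
Proof. by rewrite ge_max ler01 gerBl cabs_ge0. Qed.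

Lemma tent_eq0 z : 1 <= cabs z -> tent z = 0.
Proof. by move=> z1; apply/max_idPl; rewrite subr_le0. Qed.

Lemma tent_lipschitz z z' : `|tent z - tent z'| <= cabs (z - z').
Proof.
have := dist_cabs_le z z'; rewrite /tent !ler_norml => /andP[? ?].
by rewrite /Num.max; case: ltP => ?; case: ltP => ?; apply/andP; split; lra.
Qed.

Lemma tent_rot z u : cabs u = 1 -> tent (z * u) = tent z.
Proof. by move=> u1; rewrite /tent cabsM u1 mulr1. Qed.

Lemma measurable_tent (w : R[i]) :
  measurable_fun setT (fun p : R * R => tent (cpt p - w)).
Proof.
apply: (entire_measurable_comp (w := tent) (entire_shift (- w))) => z z'.
exact: tent_lipschitz.
Qed.

Lemma unit_circle (t : R) : cabs (Complex (cos t) (sin t)) = 1.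
Proof. by rewrite cabsE cos2Dsin2 sqrtr1. Qed.

Lemma cpt_rot (p : R * R) (c s : R) :
  cpt (c * p.1 - s * p.2, s * p.1 + c * p.2) = cpt p * Complex c s.
Proof.
by apply/eqP; rewrite eq_complex/=; apply/andP; split; apply/eqP; ring.
Qed.

Lemma tent_le_square (z : R[i]) (p : R * R) :
  tent (cpt p - z) <= \1_(square 1 z) p.
Proof.
rewrite indicE; have [p1|/ltW p1] := leP 1 (cabs (cpt p - z)).
  by rewrite tent_eq0.
by rewrite mem_set ?tent_le1//; exact: cabs_square.
Qed.

Lemma integrable_tent (w : R[i]) :
  (@area R).-integrable setT (fun p => (tent (cpt p - w))%:E).
Proof.
apply: (@le_integrable _ _ R (@area R) setT measurableT _
    (fun p => (\1_(square 1 w) p)%:E)).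
- by apply/measurable_EFinP; exact: measurable_tent.
- by move=> p _; rewrite !gee0_abs ?lee_fin ?tent_ge0 ?tent_le_square.
- exact: integrable_square.
Qed.

(** The tent is radial, so rotating the variable changes only the argument of [f]. Averaging over
    the angle and exchanging integrals leaves the circle mean at each point. *)
Lemma tent_mean0 (f : R[i] -> R[i]) (w : R[i]) : entire f ->
  (\int[@area R]_p (`|complex.Re (f (cpt p + w)) * tent (cpt p)|)%:E < +oo)%E ->
  (\int[@area R]_p (complex.Re (f (cpt p + w)) * tent (cpt p))%:E =
   \int[@area R]_p (complex.Re (f w) * tent (cpt p))%:E)%E.
Proof.
move=> ef Cfin.
pose U (p : R * R) := complex.Re (f (cpt p + w)) * tent (cpt p).
have efw : entire (fun z => f (z + w)) := entire_comp ef (entire_shift w).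
have mtent : measurable_fun setT (fun p : R * R => tent (cpt p)).
  by have := measurable_tent 0; congr measurable_fun; apply/funext => p; rewrite subr0.
have mU : measurable_fun setT U.
  by apply: measurable_funM => //; exact: (entire_measurable_Re efw).
pose rot (x : R * (R * R)) : R * R :=
  (cos x.1 * x.2.1 - sin x.1 * x.2.2, sin x.1 * x.2.1 + cos x.1 * x.2.2).
have mcos : measurable_fun setT (fun x : R * (R * R) => cos x.1).
  apply: measurableT_comp => //; apply: continuous_measurable_fun.
  exact: continuous_cos.
have msin : measurable_fun setT (fun x : R * (R * R) => sin x.1).
  apply: measurableT_comp => //; apply: continuous_measurable_fun.
  exact: continuous_sin.
have m1 : measurable_fun setT (fun x : R * (R * R) => x.2.1).
  exact: measurableT_comp.
have m2 : measurable_fun setT (fun x : R * (R * R) => x.2.2).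
  exact: measurableT_comp.
have mrot : measurable_fun setT rot.
  apply: measurable_fun_pair => /=.
    by apply: measurable_funB; exact: measurable_funM.
  by apply: measurable_funD; exact: measurable_funM.
pose G (x : R * (R * R)) : \bar R := (U (rot x))%:E.
have mG : measurable_fun setT G.
  by apply/measurable_EFinP; exact: measurableT_comp mU mrot.
have rotP t : area_preserving (fun p => rot (t, p)).
  by apply: (area_preserving_rotation (c := cos t) (s := sin t)); rewrite cos2Dsin2.
have pp : 0 < pi *+ 2 :> R by rewrite mulrn_wgt0// pi_gt0.
pose D : set R := `[0, pi *+ 2]%classic.
have muD : mu D = (pi *+ 2)%:E.
  by rewrite /D lebesgue_measure_itv/= lte_fin pp sube0.
have mUE : measurable_fun setT (EFin \o U) by exact/measurable_EFinP.
pose I := (\int[@area R]_p (U p)%:E)%E.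
pose C := (\int[@area R]_p (`|U p|)%:E)%E.
have GE t p : G (t, p) =
  (tent (cpt p) * complex.Re (f (cpt p * Complex (cos t) (sin t) + w)))%:E.
  by rewrite /G /U /rot cpt_rot/= tent_rot ?unit_circle// mulrC.
have GD p : (\int[mu]_(t in D) G (t, p) =
    (pi *+ 2)%:E * (complex.Re (f w) * tent (cpt p))%:E)%E.
  under eq_integral do rewrite GE EFinM.
  have ic := continuous_itv_integrable 0 (pi *+ 2)
    (@continuous_circle R f (cpt p) w ef).
  have J : (\int[mu]_(t in D)
      (complex.Re (f (cpt p * Complex (cos t) (sin t) + w)))%:E =
      (complex.Re (f w) * (pi *+ 2))%:E)%E.
    rewrite -(circle_mean (cpt p) w ef) /Rintegral fineK//.
    exact: (integrable_fin_num _ ic).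
  have mD : measurable D by exact: measurable_itv.
  rewrite (@integralZl _ _ R mu D mD _ ic) J -!EFinM; congr EFin; ring.
(* Every rotated slice has the integral [I] and the absolute integral [C], by invariance of area. *)
have : (I * mu D = \int[@area R]_p \int[mu]_(t in D) G (t, p))%E.
  apply: (@fubini_average _ _ _ _ R mu (@area R) D G C I) => //.
  - exact: measurable_itv.
  - by move: (ltry (pi *+ 2 : R)); rewrite -muD.
  - by rewrite /C Cfin andbT; apply: integral_ge0 => p _; rewrite lee_fin.
  - move=> t _.
    exact: (area_preserving_integral (rotP t)
      (measurableT_comp (@abse_measurable _ _) mUE)).
  - by move=> t _; exact: (area_preserving_integral (rotP t) mUE).
under [RHS]eq_integral do rewrite GD.
rewrite muD muleC integralZl//; last first.
  have := integrableZl measurableT (complex.Re (f w)) (integrable_tent 0).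
  by apply: eq_integrable => // p _; rewrite EFinM subr0.
move=> /(congr1 (fun x => ((pi *+ 2)^-1)%:E * x)%E).
by rewrite !muleA -!EFinM mulVf ?gt_eqF// !mul1e.
Qed.

(** A translation by [w] reduces to the tent at the origin. The mass keeps the form [cpt p - 0] to
    match [integrable_tent]. *)
Lemma tent_mean (f : R[i] -> R[i]) (w : R[i]) : entire f ->
  (@area R).-integrable setT
    (fun p => (complex.Re (f (cpt p)) * tent (cpt p - w))%:E) ->
  \int[@area R]_p (complex.Re (f (cpt p)) * tent (cpt p - w)) =
  complex.Re (f w) * \int[@area R]_p tent (cpt p - 0).
Proof.
move=> ef /integrableP[mf ff].
have tP := area_preserving_translation (complex.Re w, complex.Im w).
have cptD (p : R * R) :
    cpt (complex.Re w + p.1, complex.Im w + p.2) = cpt p + w.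
  by case: (w) => a b; rewrite /cpt /=; apply/eqP;
    rewrite eq_complex /= ![_ + p.1]addrC ![_ + p.2]addrC !eqxx.
rewrite -RintegralZl//; last exact: integrable_tent.
rewrite /Rintegral; congr fine.
rewrite -(area_preserving_integral tP mf) /=.
under eq_integral do rewrite cptD addrK.
rewrite tent_mean0//; first by apply: eq_integral => p _; rewrite subr0.
have := area_preserving_integral tP (measurableT_comp (@abse_measurable _ _) mf).
rewrite /= => H; move: ff; rewrite -H; congr (_ < _)%E.
by apply: eq_integral => p _; rewrite cptD addrK.
Qed.

(** On the square of half-side 1/4 the modulus is at most 1/2, so the tent is at least 1/2 there. *)
Lemma tent_mass_gt0 : 0 < \int[@area R]_p tent (cpt p - 0).
Proof.
apply: (@lt_le_trans _ _ (\int[@area R]_p (2^-1 * \1_(square (4^-1) 0) p))).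
  rewrite RintegralZl//; last by apply: integrable_square; rewrite invr_gt0.
  rewrite /Rintegral integral_square ?invr_gt0//= !mulr_gt0 ?invr_gt0//.
apply: le_Rintegral => //; last 2 first.
- exact: integrable_tent.
- move=> p _; rewrite indicE; case: (boolP (p \in _)) => [|_].
    rewrite inE => /square_cabs; rewrite mulr1 /tent => pw.
    by rewrite le_max; apply/orP; right; lra.
  by rewrite mulr0 tent_ge0.
have h4 : 0 < 4^-1 :> R by rewrite invr_gt0.
have := integrableZl measurableT (2^-1) (integrable_square 0 h4).
by apply: eq_integrable => // p _; rewrite EFinM.
Qed.

End tent.

(** * Local integral and Lipschitz bounds for Fock functions *)

Section local_estimates.
Context {R : realType}.
Variable nu : R.
Hypothesis nu1 : 1 <= nu.
Implicit Types (f : R[i] -> R[i]) (w : R[i]) (p : R * R).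

Let nu_gt0 : 0 < nu. Proof. exact: lt_le_trans nu1. Qed.

Definition fock_density f p : R :=
  cabs (f (cpt p)) `^ nu * expR (- (nu * cabs (cpt p) ^+ 2) / 2).

Lemma fock_density_ge0 f p : 0 <= fock_density f p.
Proof. by rewrite mulr_ge0 ?powR_ge0 ?expR_ge0. Qed.

Lemma fock_densityE f p :
  fock_density f p = (cabs (f (cpt p)) * expR (- (cabs (cpt p) ^+ 2 / 2))) `^ nu.
Proof.
rewrite powRM ?cabs_ge0 ?expR_ge0// -expRM; congr (_ * expR _).
by field.
Qed.

Lemma measurable_fock_density f : entire f -> measurable_fun setT (fock_density f).
Proof.
move=> ef; apply: measurable_funM.
  by apply: (measurableT_comp (measurable_powR _)); exact: entire_measurable_cabs.
apply: measurableT_comp => //.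
apply: measurable_funM => //; apply: measurableT_comp => //.
apply: measurable_funM => //; apply: measurable_funX.
have := entire_measurable_cabs (entire_shift (0 : R[i])).
by congr measurable_fun; apply/funext => p; rewrite addr0.
Qed.

(* [s <= 1 + s ^ nu], applied to [s = t / lambda]. *)
Lemma ler_scaled_powR (t lambda : R) : 0 <= t -> 0 < lambda ->
  t <= lambda * (1 + t `^ nu / lambda `^ nu).
Proof.
move=> t0 l0; have tl0 : 0 <= t / lambda by rewrite divr_ge0// ltW.
have -> : t `^ nu / lambda `^ nu = (t / lambda) `^ nu.
  have := powRM nu tl0 (ltW l0); rewrite divfK ?gt_eqF// => ->.
  by rewrite mulfK// gt_eqF// powR_gt0.
rewrite -ler_pdivrMl// mulrC; have [s1|/ltW s1] := leP (t / lambda) 1.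
  by apply: le_trans s1 _; rewrite lerDl powR_ge0.
by apply: le_trans (le1r_powR s1 nu1) _; rewrite lerDr.
Qed.

(** On the square [cabs z <= M + 2], so removing the Gaussian weight costs at most the factor [E].
    Then [ler_scaled_powR] takes the place of Hölder's inequality: the area 4 of the square plus a
    normalised integral of at most 1 gives 5. *)
Lemma local_L1_bound f w (lambda M : R) : entire f -> 0 < lambda ->
  (fock_integral nu f <= (lambda `^ nu)%:E)%E -> cabs w <= M ->
  (\int[@area R]_p (cabs (f (cpt p)) * \1_(square 1 w) p)%:E <=
   (5 * lambda * expR ((M + 2) ^+ 2 / 2))%:E)%E.
Proof.
move=> ef l0 fl wM; set E := expR ((M + 2) ^+ 2 / 2).
have ln0 : 0 < lambda `^ nu by rewrite powR_gt0.
have E0 : 0 < E by exact: expR_gt0.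
have El0 : 0 < E * lambda by rewrite mulr_gt0.
have mS : measurable_fun setT (\1_(square 1 w) : R * R -> R).
  by apply: measurable_indic; exact: measurable_square.
have mD := measurable_fock_density ef.
apply: (@le_trans _ _ (\int[@area R]_p
  ((E * lambda)%:E * ((\1_(square 1 w) p)%:E
     + ((lambda `^ nu)^-1)%:E * (fock_density f p)%:E)))%E).
  apply: ge0_le_integral => //.
  - by move=> p _; rewrite lee_fin mulr_ge0 ?cabs_ge0.
  - by apply/measurable_EFinP/measurable_funM => //; exact: entire_measurable_cabs.
  - have : measurable_fun setT (EFin \o (fun p : R * R => (E * lambda) *
        (\1_(square 1 w) p + (lambda `^ nu)^-1 * fock_density f p))).
      apply/measurable_EFinP; apply: measurable_funM => //.
      by apply: measurable_funD => //; exact: measurable_funM.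
    by congr measurable_fun.
  - move=> p _; rewrite [leRHS](_ : _ = (E * lambda * (\1_(square 1 w) p
      + (lambda `^ nu)^-1 * fock_density f p))%:E)// lee_fin.
    rewrite [X in _ * X <= _]indicE [X in _ <= _ * (X + _)]indicE.
    case: (boolP (p \in square 1 w)) => pw; last first.
      rewrite mulr0 add0r mulr_ge0 ?(ltW El0)// mulr_ge0 ?fock_density_ge0//.
      by rewrite invr_ge0 ltW.
    rewrite mulr1 -mulrA.
    have z2 : cabs (cpt p) <= M + 2.
      have := pw; rewrite inE => /square_cabs; rewrite mulr1 => pw2.
      by rewrite -(subrK w (cpt p)) addrC (le_trans (cabsD _ _))// lerD.
    set t := cabs (f (cpt p)) * expR (- (cabs (cpt p) ^+ 2 / 2)).
    have t0 : 0 <= t by rewrite mulr_ge0 ?cabs_ge0 ?expR_ge0.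
    apply: (@le_trans _ _ (E * t)).
      rewrite /t mulrCA ler_peMr ?cabs_ge0// /E -expRD.
      apply: le_trans (expR_ge1Dx _); rewrite lerDl subr_ge0 ler_pM2r ?invr_gt0//.
      apply: lerXn2r; rewrite ?nnegrE ?cabs_ge0//.
      exact: le_trans (cabs_ge0 _) z2.
    rewrite ler_pM2l// fock_densityE -/t [_^-1 * _]mulrC.
    exact: ler_scaled_powR.
rewrite ge0_integralZl_EFin//=; last 3 first.
- by move=> p _; rewrite adde_ge0// lee_fin mulr_ge0 ?fock_density_ge0// invr_ge0 ltW.
- apply: emeasurable_funD; first exact/measurable_EFinP.
  by apply: emeasurable_funM => //; exact/measurable_EFinP.
- exact: ltW.
rewrite ge0_integralD//=; last 3 first.
- exact/measurable_EFinP.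
- by move=> p _; rewrite lee_fin mulr_ge0 ?fock_density_ge0// invr_ge0 ltW.
- by apply: emeasurable_funM => //; exact/measurable_EFinP.
rewrite integral_square// ge0_integralZl_EFin//=; last 3 first.
- by move=> p _; rewrite lee_fin fock_density_ge0.
- exact/measurable_EFinP.
- by rewrite invr_ge0 ltW.
apply: (@le_trans _ _ ((E * lambda)%:E * (4%:E + 1%:E))%E).
  rewrite lee_pmul2l// ?lte_fin// leeD//.
    by rewrite lee_fin mulr1 expr2; lra.
  rewrite -(@mulVf _ (lambda `^ nu)) ?gt_eqF// EFinM lee_pmul2l// ?lte_fin ?invr_gt0//.
rewrite -EFinD -EFinM lee_fin le_eqVlt; apply/orP; left; apply/eqP; ring.
Qed.

(** Subtract the mean value identities at [w] and [w']: the two tents differ by at most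
    [cabs (w - w')] and vanish off the two squares, each of which contributes one local bound. *)
Lemma fock_lipschitz_Re f (lambda M : R) w w' : entire f -> 0 < lambda ->
  (fock_integral nu f <= (lambda `^ nu)%:E)%E -> cabs w <= M -> cabs w' <= M ->
  (\int[@area R]_p tent (cpt p - 0)) * `|complex.Re (f w) - complex.Re (f w')| <=
  10 * lambda * expR ((M + 2) ^+ 2 / 2) * cabs (w - w').
Proof.
move=> ef l0 fl wM wM'; set B := 5 * lambda * expR ((M + 2) ^+ 2 / 2).
pose L v p := cabs (f (cpt p)) * \1_(square 1 v) p.
pose h v p := complex.Re (f (cpt p)) * tent (cpt p - v).
have mRe := entire_measurable_Re ef.
have mL v : measurable_fun setT (L v).
  apply: measurable_funM; first exact: entire_measurable_cabs.
  by apply: measurable_indic; exact: measurable_square.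
have L0 v p : 0 <= L v p by rewrite mulr_ge0 ?cabs_ge0.
have hL v p : `|h v p| <= L v p.
  rewrite normrM ler_pM// ?normr_Re_le//.
  by rewrite ger0_norm ?tent_ge0 ?tent_le_square.
have mh v : measurable_fun setT (h v).
  by apply: measurable_funM => //; exact: measurable_tent.
have LB v : cabs v <= M -> (\int[@area R]_p (L v p)%:E <= B%:E)%E.
  exact: local_L1_bound.
have iL v : cabs v <= M -> (@area R).-integrable setT (EFin \o L v).
  move=> vM; apply/integrableP; split; first by apply/measurable_EFinP; exact: mL.
  under eq_integral do rewrite /= ger0_norm ?L0//.
  by rewrite (le_lt_trans (LB v vM)) ?ltry.
have ih v : cabs v <= M -> (@area R).-integrable setT (EFin \o h v).
  move=> vM; apply: (le_integrable measurableT _ _ (iL v vM)).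
    by apply/measurable_EFinP; exact: mh.
  by move=> p _; rewrite /= lee_fin (le_trans (hL v p))// ler_norm.
have LBr v : cabs v <= M -> \int[@area R]_p (L v p) <= B.
  move=> vM; rewrite -lee_fin /Rintegral fineK ?LB//.
  exact: integrable_fin_num (iL v vM).
have hdiff p : `|h w p - h w' p| <= cabs (w - w') * (L w p + L w' p).
  rewrite /h -mulrBr normrM /L -mulrDr mulrCA.
  apply: ler_pM => //; first exact: normr_Re_le.
  have lip : `|tent (cpt p - w) - tent (cpt p - w')| <= cabs (w - w').
    apply: le_trans (tent_lipschitz _ _) _.
    by rewrite (_ : _ - _ = w' - w) 1?cabs_distC//; ring.
  have := tent_le_square w p; have := tent_le_square w' p.
  have := tent_ge0 (cpt p - w); have := tent_ge0 (cpt p - w').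
  rewrite !indicE; case: (boolP (p \in square 1 w)) => _;
    case: (boolP (p \in square 1 w')) => _ /=.
  - by move=> _ _ _ _; rewrite (le_trans lip)// ler_peMr ?cabs_ge0// lerDl.
  - by move=> _ _ _ _; rewrite addr0 mulr1.
  - by move=> _ _ _ _; rewrite add0r mulr1.
  (* Off both squares both tents are zero. *)
  - move=> t'0 t0 t'0' t0'.
    have -> : tent (cpt p - w) = 0 by lra.
    have -> : tent (cpt p - w') = 0 by lra.
    by rewrite addr0 mulr0 subrr normr0.
have mean v : cabs v <= M -> complex.Re (f v) * \int[@area R]_p tent (cpt p - 0) =
    \int[@area R]_p (h v p).
  by move=> vM; rewrite -tent_mean//; exact: ih.
rewrite -{1}(gtr0_norm (@tent_mass_gt0 R)) -normrM mulrC mulrBl !mean//.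
rewrite -RintegralB//; [|exact: ih|exact: ih].
have iB := integrableB measurableT (ih w wM) (ih w' wM').
apply: le_trans (le_normr_Rintegral measurableT iB) _.
have iD := integrableD measurableT (iL w wM) (iL w' wM').
have iZ := integrableZl measurableT (cabs (w - w')) iD.
apply: (@le_trans _ _ (\int[@area R]_p (cabs (w - w') * (L w p + L w' p)))).
  by apply: le_Rintegral => //; exact: (integrable_abse iB).
rewrite RintegralZl//= RintegralD//; [|exact: iL|exact: iL].
rewrite mulrC ler_wpM2r ?cabs_ge0//.
apply: le_trans (lerD (LBr w wM) (LBr w' wM')) _.
rewrite /B le_eqVlt; apply/orP; left; apply/eqP; ring.
Qed.

(** Multiplication by [- i] preserves the modulus and turns the imaginary part into the real
    part. *)
Lemma fock_lipschitz f (lambda M : R) w w' : entire f -> 0 < lambda ->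
  (fock_integral nu f <= (lambda `^ nu)%:E)%E -> cabs w <= M -> cabs w' <= M ->
  (\int[@area R]_p tent (cpt p - 0)) * cabs (f w - f w') <=
  20 * lambda * expR ((M + 2) ^+ 2 / 2) * cabs (w - w').
Proof.
move=> ef l0 fl wM wM'; pose g z := Complex 0 (-1) * f z.
have eg : entire g.
  have := entire_comp (entire_affine (Complex 0 (-1)) 0) ef.
  by congr entire; apply/funext => z; rewrite /= addr0.
have ci : cabs (Complex 0 (-1) : R[i]) = 1.
  by rewrite cabsE expr0n sqrrN expr1n add0r sqrtr1.
have gl : (fock_integral nu g <= (lambda `^ nu)%:E)%E.
  apply: le_trans fl; rewrite /fock_integral le_eqVlt; apply/orP; left; apply/eqP.
  by apply: eq_integral => p _; rewrite /g cabsM ci mul1r.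
have ReG z : complex.Re (g z) = complex.Im (f z).
  by rewrite /g; case: (f z) => a b /=; ring.
have H1 := fock_lipschitz_Re ef l0 fl wM wM'.
have H2 := fock_lipschitz_Re eg l0 gl wM wM'.
rewrite !ReG in H2.
have := cabs_le_ReIm (f w - f w'); rewrite ReB ImB.
move=> H; apply: le_trans (ler_wpM2l (ltW (@tent_mass_gt0 R)) H) _.
rewrite mulrDr; apply: le_trans (lerD H1 H2) _.
rewrite le_eqVlt; apply/orP; left; apply/eqP; ring.
Qed.

End local_estimates.

(** * Integrability of Gaussians *)

Section gaussian.
Context {R : realType}.
Local Notation mu := (@lebesgue_measure R).

(** Up to a constant this is the centred normal density of variance [1 / (2 * s)]. *)
Lemma integrable_gaussian (s : R) : 0 < s ->
  mu.-integrable setT (fun x => (expR (- (s * x ^+ 2)))%:E).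
Proof.
move=> s0; pose sigma := Num.sqrt ((2 * s)^-1).
have s20 : 0 < (2 * s)^-1 by rewrite invr_gt0 mulr_gt0.
have sg0 : sigma != 0 by rewrite gt_eqF// sqrtr_gt0.
have sg2 : sigma ^+ 2 *+ 2 = s^-1.
  by rewrite sqr_sqrtr ?ltW// -mulr_natr invfM mulrC mulrA divff ?mul1r.
have := integrableZl measurableT ((normal_peak sigma)^-1)
  (integrable_normal_pdf 0 sigma).
apply: eq_integrable => // x _; rewrite /normal_pdf (negbTE sg0) /normal_fun.
rewrite -EFinM mulKf; last by rewrite gt_eqF// normal_peak_gt0.
by rewrite subr0 sg2 invrK mulNr mulrC.
Qed.

Lemma integral_gaussian_area (s : R) : 0 < s ->
  (\int[@area R]_p (expR (- (s * (p.1 ^+ 2 + p.2 ^+ 2))))%:E < +oo)%E.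
Proof.
move=> s0; have ig := integrable_gaussian s0.
pose g := (\int[mu]_x (expR (- (s * x ^+ 2)))%:E)%E.
have m1 : measurable_fun setT (fun p : R * R => expR (- (s * (p.1 ^+ 2 + p.2 ^+ 2)))).
  apply: measurableT_comp => //; apply: measurableT_comp => //.
  apply: measurable_funM => //; apply: measurable_funD; exact: measurable_funX.
pose F (p : R * R) := (expR (- (s * (p.1 ^+ 2 + p.2 ^+ 2))))%:E.
have mF : measurable_fun setT F by exact/measurable_EFinP.
have F0 p : (0 <= F p)%E by rewrite lee_fin expR_ge0.
have FE : (\int[@area R]_p F p = \int[mu]_x \int[mu]_y F (x, y))%E.
  by rewrite /area fubini_tonelli1.
rewrite [ltLHS]FE (_ : (\int[_]_x _)%E = (\int[mu]_x (g * (expR (- (s * x ^+ 2)))%:E))%E).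
  by rewrite /g -(fineK (integrable_fin_num measurableT ig)) integralZl// -/g
    -[X in (_ * X)%E](fineK (integrable_fin_num measurableT ig)) -EFinM ltry.
apply: eq_integral => x _; rewrite /F.
under eq_integral do rewrite mulrDr opprD expRD EFinM.
by rewrite muleC -(integralZl measurableT ig).
Qed.

End gaussian.

(** * Lipschitz bound in terms of the Fock norm, and Gaussian majorants *)

Section fock_bounds.
Context {R : realType}.
Variable nu : R.
Hypothesis nu1 : 1 <= nu.
Implicit Types (f h : R[i] -> R[i]) (w z : R[i]).

Let nu_gt0 : 0 < nu. Proof. exact: lt_le_trans nu1. Qed.

Let c0 : R := nu / (2 * pi).
Let c0_gt0 : 0 < c0.
Proof. by rewrite divr_gt0// mulr_gt0// pi_gt0. Qed.

Lemma fock_integral_ge0 f : (0 <= fock_integral nu f)%E.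
Proof. by apply: integral_ge0 => p _; rewrite lee_fin (fock_density_ge0 nu f). Qed.

Lemma powRK (x : R) : 0 <= x -> (x `^ nu^-1) `^ nu = x.
Proof. by move=> x0; rewrite -powRrM mulVf ?gt_eqF// powRr1. Qed.

Lemma powRVK (x : R) : 0 <= x -> (x `^ nu) `^ nu^-1 = x.
Proof. by move=> x0; rewrite -powRrM divff ?gt_eqF// powRr1. Qed.

Lemma fock_norm_ge0 f : 0 <= fock_norm nu f.
Proof. exact: powR_ge0. Qed.

Lemma fock_norm_lipschitz : exists2 C : R, 0 <= C &
  forall f (M : R) w w', in_fock nu f -> cabs w <= M -> cabs w' <= M ->
  cabs (f w - f w') <= C * fock_norm nu f * expR ((M + 2) ^+ 2 / 2) * cabs (w - w').
Proof.
pose K : R := \int[@area R]_p tent (cpt p - 0).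
have K0 : 0 < K by exact: tent_mass_gt0.
exists (20 * (c0^-1) `^ nu^-1 / K).
  by rewrite divr_ge0 ?mulr_ge0 ?powR_ge0 ?ltW.
move=> f M w w' [ef foo] wM wM'; set E := expR _; set d := cabs (w - w').
have f0 := fock_integral_ge0 f.
have ffin : fock_integral nu f \is a fin_num by rewrite ge0_fin_numE.
have i0 : 0 <= fine (fock_integral nu f) by rewrite fine_ge0.
(* [l0] is the norm without its normalising constant; it may be zero, so the estimate is applied
   with [l0 + eps] and [eps] is then sent to 0. *)
pose l0 := (c0^-1) `^ nu^-1 * fock_norm nu f.
have l0E : l0 `^ nu = fine (fock_integral nu f).
  rewrite /l0 powRM ?powR_ge0// powRK ?invr_ge0 ?ltW// /fock_norm -/c0 powRK.
    by rewrite mulKf// gt_eqF.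
  by rewrite mulr_ge0// ltW.
have l00 : 0 <= l0 by rewrite mulr_ge0 ?powR_ge0.
have E0 : 0 < E by exact: expR_gt0.
have d0 : 0 <= d by exact: cabs_ge0.
have step : K * cabs (f w - f w') <= 20 * l0 * E * d.
  apply/ler_addgt0Pr => e e0.
  have D0 : 0 < 20 * E * d + 1 by rewrite ltr_wpDl// !mulr_ge0// ltW.
  pose eps := e / (20 * E * d + 1).
  have eps0 : 0 < eps by rewrite divr_gt0.
  have l1 : 0 < l0 + eps by rewrite ltr_wpDl.
  have fl : (fock_integral nu f <= ((l0 + eps) `^ nu)%:E)%E.
    rewrite -(fineK ffin) -l0E lee_fin.
    apply: ge0_ler_powR; rewrite ?nnegrE ?(ltW nu_gt0) ?(ltW l1)//.
    by rewrite lerDl ltW.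
  apply: le_trans (fock_lipschitz nu1 ef l1 fl wM wM') _.
  rewrite -/E -/d (_ : _ * d = 20 * l0 * E * d + eps * (20 * E * d)); last by ring.
  rewrite lerD2l /eps mulrAC ler_pdivrMr// ler_pM2l//.
  by rewrite lerDl.
rewrite -(ler_pM2l K0); apply: le_trans step _.
rewrite le_eqVlt; apply/orP; left; apply/eqP; rewrite /l0.
by field; rewrite gt_eqF.
Qed.

(** Because [A < 1], the weight leaves a Gaussian decay that absorbs the linear factor. [G] is
    independent of [h] and [m], and this uniformity is what yields convergence in operator norm. *)
Lemma fock_gaussian_bound (A B q : R) : 0 <= A < 1 -> 0 <= q ->
  exists2 G : R, 0 <= G & forall h (m : R), entire h -> 0 <= m ->
  (forall z, cabs (h z) <= m * (cabs z + q) * expR ((A * cabs z + B) ^+ 2 / 2)) ->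
  (fock_integral nu h <= (m `^ nu * G)%:E)%E.
Proof.
move=> /andP[A0 A1] q0.
have A2 : 0 < 1 - A ^+ 2 by rewrite subr_gt0 exprn_ilt1.
(* The decay coefficient is [(1 - A ^+ 2) / 2 = 4 * s]. Two parts [s] absorb the linear term
   [A * B * r], at the cost of the constant [c / 2]; one absorbs [r + q]; one remains. *)
pose c := B ^+ 2 + 2 * (A * B) ^+ 2 / (1 - A ^+ 2).
pose s := (1 - A ^+ 2) / 8; have s0 : 0 < s by rewrite divr_gt0.
pose kappa := (1 + q + s^-1) * expR (c / 2).
have k0 : 0 <= kappa.
  by rewrite mulr_ge0 ?expR_ge0// addr_ge0 ?invr_ge0 ?(ltW s0)// addr_ge0.
have gfin := integral_gaussian_area s0.
set g := (\int[_]_p _)%E in gfin.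
have g0 : (0 <= g)%E by apply: integral_ge0 => p _; rewrite lee_fin expR_ge0.
exists (kappa `^ nu * fine g); first by rewrite mulr_ge0 ?powR_ge0 ?fine_ge0.
move=> h m eh m0 hm.
have scalar (r : R) : 0 <= r ->
    (r + q) * expR ((A * r + B) ^+ 2 / 2) * expR (- (r ^+ 2 / 2)) <=
    kappa * expR (- (s * r ^+ 2)).
  move=> r0; rewrite -mulrA -expRD /kappa -mulrA -expRD.
  have rq : r + q <= (1 + q + s^-1) * expR (s * r ^+ 2).
    apply: (@le_trans _ _ ((1 + q + s^-1) * (1 + s * r ^+ 2))); last first.
      rewrite ler_wpM2l ?expR_ge1Dx// addr_ge0 ?invr_ge0 ?(ltW s0)// addr_ge0//.
    have -> : (1 + q + s^-1) * (1 + s * r ^+ 2) =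
       1 + q + s^-1 + (1 + q) * (s * r ^+ 2) + r ^+ 2 by field; rewrite gt_eqF.
    have : 0 <= (1 + q) * (s * r ^+ 2).
      apply: mulr_ge0; first exact: addr_ge0.
      by apply: mulr_ge0; [exact: ltW|exact: sqr_ge0].
    have : 0 <= s^-1 by rewrite invr_ge0 ltW.
    have := sqr_ge0 (r - 1); nra.
  apply: le_trans (ler_wpM2r (expR_ge0 _) rq) _.
  rewrite -mulrA -expRD ler_wpM2l//.
    by rewrite addr_ge0 ?invr_ge0 ?(ltW s0)// addr_ge0.
  rewrite ler_expR.
  have sq : 0 <= ((1 - A ^+ 2) * r - 2 * (A * B)) ^+ 2 / (2 * (1 - A ^+ 2)).
    by rewrite divr_ge0 ?sqr_ge0// mulr_ge0// ltW.
  rewrite -subr_ge0; apply: le_trans (mulr_ge0 sq (ltW (_ : 0 < 2^-1))) _.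
    by rewrite invr_gt0.
  rewrite le_eqVlt; apply/orP; left; apply/eqP; rewrite /c /s.
  by field; rewrite gt_eqF.
have mk0 : 0 <= (m * kappa) `^ nu by exact: powR_ge0.
rewrite mulrA -powRM// EFinM fineK ?ge0_fin_numE//.
rewrite -ge0_integralZl_EFin//; last first.
  apply/measurable_EFinP; apply: measurableT_comp => //; apply: measurableT_comp => //.
  by apply: measurable_funM => //; apply: measurable_funD; exact: measurable_funX.
apply: ge0_le_integral => //.
- by move=> p _; rewrite lee_fin (fock_density_ge0 nu h).
- by apply/measurable_EFinP; exact: (measurable_fock_density nu eh).
- apply/measurable_EFinP; apply: measurable_funM => //.
  apply: measurableT_comp => //; apply: measurableT_comp => //.
  by apply: measurable_funM => //; apply: measurable_funD; exact: measurable_funX.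
move=> p _; rewrite -EFinM lee_fin -/(fock_density nu h p) fock_densityE//.
have cp : cabs (cpt p) ^+ 2 = p.1 ^+ 2 + p.2 ^+ 2 by exact: sqr_cabs.
apply: (@le_trans _ _ ((m * kappa * expR (- (s * cabs (cpt p) ^+ 2))) `^ nu)).
  apply: ge0_ler_powR.
  - exact: ltW.
  - by rewrite nnegrE mulr_ge0 ?cabs_ge0 ?expR_ge0.
  - by rewrite nnegrE; apply: mulr_ge0; [exact: mulr_ge0|exact: expR_ge0].
  apply: le_trans (ler_wpM2r (expR_ge0 _) (hm _)) _.
  have := ler_wpM2l m0 (scalar _ (cabs_ge0 (cpt p))).
  by rewrite [m * (kappa * _)]mulrA [m * (_ * _ * _)]mulrA [m * (_ * _)]mulrA.
rewrite powRM ?expR_ge0//; last exact: mulr_ge0.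
(* As [nu >= 1], the [nu]-th power of the Gaussian is at most the Gaussian itself. *)
rewrite ler_wpM2l// cp -expRM ler_expR.
rewrite mulNr lerN2 ler_peMr// mulr_ge0 ?(ltW s0)// addr_ge0 ?sqr_ge0//.
Qed.

Lemma fock_norm_bound h (m G : R) : 0 <= m -> 0 <= G ->
  (fock_integral nu h <= (m `^ nu * G)%:E)%E ->
  fock_norm nu h <= m * (c0 * G) `^ nu^-1.
Proof.
move=> m0 G0 hG; have h0 := fock_integral_ge0 h.
(* Finiteness ensures that [fine] in [fock_norm] returns the integral and not the default 0 for
   infinity. *)
have hfin : fock_integral nu h \is a fin_num.
  by rewrite ge0_fin_numE// (le_lt_trans hG) ?ltry.
have cG : 0 <= c0 * G by apply: mulr_ge0 => //; exact: ltW.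
rewrite -[m in leRHS]powRVK// -powRM ?powR_ge0//.
rewrite /fock_norm -/c0; apply: ge0_ler_powR.
- by rewrite invr_ge0 ltW.
- by rewrite nnegrE; apply: mulr_ge0; [exact: ltW|exact: fine_ge0].
- by rewrite nnegrE; apply: mulr_ge0 => //; exact: powR_ge0.
- rewrite mulrCA ler_wpM2l ?(ltW c0_gt0)//.
  by rewrite -lee_fin fineK.
Qed.

End fock_bounds.

(** * Iterates of affine maps and powers of a rotation *)

Section composition_iterates.
Context {R : realType}.
Implicit Types (f : R[i] -> R[i]) (a b p z : R[i]).

Lemma comp_op_iterE (phi : R[i] -> R[i]) n f :
  comp_op_iter phi n f = fun z => f (iter n phi z).
Proof.
elim: n => // n ih; apply/funext => z.
by rewrite /comp_op_iter iterS -/(comp_op_iter phi n f) ih iterSr.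
Qed.

(** Written around its fixed point [p], the map is conjugate to multiplication by [a]. *)
Lemma iter_affine a p n z :
  iter n (fun z => a * z + (1 - a) * p) z = a ^+ n * (z - p) + p.
Proof.
by elim: n => [|n ih]; [rewrite expr0 /=; ring|rewrite iterS ih exprS; ring].
Qed.

Lemma iter_scale a n z : iter n (fun z => a * z) z = a ^+ n * z.
Proof. by elim: n => [|n ih]; rewrite ?expr0 ?mul1r// iterS ih exprS mulrA. Qed.

(** The Gaussian weight is radial and rotations preserve area. *)
Lemma fock_integral_rotation (nu : R) f a : entire f -> cabs a = 1 ->
  fock_integral nu (fun z => f (a * z)) = fock_integral nu f.
Proof.
case: a => c s ef a1.
have cs : c ^+ 2 + s ^+ 2 = 1 by rewrite -sqr_cabs a1 expr1n.
have mD := measurable_fock_density nu ef.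
have mDE : measurable_fun setT (EFin \o fock_density nu f) by exact/measurable_EFinP.
have H := area_preserving_integral (area_preserving_rotation cs) mDE.
refine (etrans _ H); apply: eq_integral => p _.
by rewrite /= /fock_density cpt_rot cabsM a1 mulr1 [cpt p * _]mulrC.
Qed.

Lemma entire_id : entire (fun z => z).
Proof.
have := @entire_shift R 0.
by congr entire; apply/funext => z; rewrite addr0.
Qed.

Lemma in_fock_id (nu : R) : 1 <= nu -> in_fock nu (fun z => z).
Proof.
move=> nu1; split; first exact: entire_id.
(* With [A = B = q = 0] and [m = 1] the required bound reads [cabs z <= cabs z]. *)
have [G _ GP] := @fock_gaussian_bound R nu nu1 0 0 0
  (introT andP (conj (lexx 0) ltr01)) (lexx 0).
apply: le_lt_trans (GP (fun z => z) 1 entire_id ler01 _) (ltry _) => z.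
by rewrite mul0r !addr0 mul1r expr0n mul0r expR0 mulr1.
Qed.

(** Consecutive powers stay at the fixed distance [cabs (a - 1) > 0], so they cannot both be within
    half of it from [c]. *)
Lemma rotation_powers_not_cvg a (c : R[i]) : cabs a = 1 -> a != 1 ->
  ~ (fun n => cabs (a ^+ n.+1 - c)) @ \oo --> (0 : R).
Proof.
move=> a1 an1 /cvgrPdist_lt; pose d := cabs (a - 1).
have d0 : 0 < d by rewrite cabs_gt0 subr_eq0.
move=> /(_ (d / 2) (divr_gt0 d0 (ltr0Sn _ 1))) [N _ NP].
have := NP N (leqnn N); have := NP N.+1 (leqnSn N).
rewrite /= !sub0r !normrN !ger0_norm ?cabs_ge0// => H1 H2.
have : d <= cabs (a ^+ N.+2 - c) + cabs (a ^+ N.+1 - c).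
  apply: le_trans (cabsB _ _).
  have -> : a ^+ N.+2 - c - (a ^+ N.+1 - c) = a ^+ N.+1 * (a - 1).
    by rewrite [a ^+ N.+2]exprS; ring.
  by rewrite cabsM cabsX a1 expr1n mul1r.
by rewrite leNgt => /negP; apply; rewrite [d]splitr ltrD.
Qed.

End composition_iterates.

(** * Asymptotics of the iterates for rotations and for contractive affine maps *)

Theorem theorem2p2 (R : realType) (nu : R) (hnu : 1 <= nu) :
  (* (1) rotations *)
  (forall a : R[i], cabs a = 1 -> a != 1 ->
     let phi := fun z : R[i] => a * z in
     (forall n : nat, (1 <= n)%N -> fock_unitary nu (comp_op_iter phi n)) /\
     ~ (exists T, fock_bounded_op nu T /\
          fock_wot_cvg nu (fun n => comp_op_iter phi n.+1) T)) /\
  (* (2) contractive affine maps *)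
  (forall a b : R[i], cabs a < 1 ->
     let phi := fun z : R[i] => a * z + b in
     let P := fun (f : R[i] -> R[i]) (_ : R[i]) => f (b / (1 - a)) in
     (forall n : nat, (1 <= n)%N -> forall f, in_fock nu f ->
        in_fock nu (comp_op_iter phi n f)) /\
     fock_norm_cvg nu (fun n => comp_op_iter phi n.+1) P).
Proof.
have [C C0 CP] := fock_norm_lipschitz hnu.
split=> [a a1 an1 phi|a b a1 phi P].
  have iterE n f : comp_op_iter phi n f = fun z => f (a ^+ n * z).
    by rewrite comp_op_iterE; apply/funext => z; rewrite iter_scale.
  have fockR u f : cabs u = 1 -> in_fock nu f -> in_fock nu (fun z => f (u * z)).
    move=> u1 [ef ff]; split; last by rewrite fock_integral_rotation.
    have := entire_comp ef (entire_affine u 0).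
    by congr entire; apply/funext => z; rewrite /= addr0.
  split=> [n _|[T [_ Tcvg]]].
    have an : cabs (a ^+ n) = 1 by rewrite cabsX a1 expr1n.
    split; first by move=> f g c _ _; rewrite !iterE.
    split; first by move=> f ff; rewrite iterE; exact: fockR.
    split.
      by move=> f [ef _]; rewrite iterE /fock_norm fock_integral_rotation.
    (* Surjectivity: the preimage of [g] is its composition with the inverse rotation. *)
    move=> g gg; exists (fun z => g ((a ^+ n)^-1 * z)).
      by apply: fockR => //; rewrite cabsV an invr1.
    rewrite iterE; apply/funext => z; rewrite mulKf//.
    by rewrite -cabs_eq0 an oner_eq0.
  (* Bounded by the Lipschitz estimate at the points 1 and 0, with [M = 1]. *)
  pose L (f : R[i] -> R[i]) := f 1 - f 0.
  have LF : fock_functional nu L.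
    split=> [f g c _ _|]; first by rewrite /L; ring.
    exists (C * expR ((1 + 2) ^+ 2 / 2)) => f ff.
    have := CP f 1 1 0 ff; rewrite cabs1 cabs0 subr0 cabs1 mulr1 => H.
    by rewrite mulrAC; apply: H.
  have := Tcvg _ _ (in_fock_id hnu) LF.
  rewrite (_ : (fun n => _) = (fun n => cabs (a ^+ n.+1 - L (T (fun z => z))))).
    exact: rotation_powers_not_cvg.
  by apply/funext => n; rewrite iterE {1}/L mulr1 mulr0 subr0.
set p := b / (1 - a).
have a1n : 1 - a != 0.
  by apply: contraTneq a1 => /eqP; rewrite subr_eq0 => /eqP <-; rewrite cabs1 ltxx.
have iterE n f : comp_op_iter phi n f = fun z => f (a ^+ n * (z - p) + p).
  rewrite comp_op_iterE; apply/funext => z; rewrite -iter_affine.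
  by congr (f (iter n _ z)); apply/funext => w; rewrite /p [_ * (b / _)]mulrC divfK.
(* [B] is such that [M + 2 = A * cabs z + B] for the radius [M = A * cabs z + 2 * cabs p] used in
   [lip]. *)
set A := cabs a; set B := 2 * cabs p + 2.
have A01 : 0 <= A < 1 by rewrite cabs_ge0.
have /andP[A0 A1] := A01.
have p0 : 0 <= cabs p by exact: cabs_ge0.
have entireI n f : entire f -> entire (comp_op_iter phi n f).
  move=> ef; rewrite iterE.
  have := entire_comp ef (entire_affine (a ^+ n) (p - a ^+ n * p)).
  by congr entire; apply/funext => z /=; congr f; ring.
have lip n f z : (0 < n)%N -> in_fock nu f ->
    cabs (comp_op_iter phi n f z - f p) <=
    C * fock_norm nu f * A ^+ n * (cabs z + cabs p) *
    expR ((A * cabs z + B) ^+ 2 / 2).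
  move=> n0 ff; rewrite iterE.
  (* Positivity of [n] enters here: it keeps the coefficient of [cabs z] in the exponent at most
     [A < 1], uniformly in [n]. *)
  have AnA : A ^+ n <= A by rewrite -[leRHS]expr1 ler_wiXn2l// ltW.
  have zp : cabs (z - p) <= cabs z + cabs p by exact: cabsB.
  have zp0 : 0 <= cabs z + cabs p by rewrite addr_ge0 ?cabs_ge0.
  have dist : cabs (a ^+ n * (z - p)) <= A ^+ n * (cabs z + cabs p).
    by rewrite cabsM cabsX ler_wpM2l// exprn_ge0.
  pose M := A * cabs z + 2 * cabs p.
  have pM : cabs p <= M.
    by rewrite /M; have := mulr_ge0 A0 (cabs_ge0 z); lra.
  have wM : cabs (a ^+ n * (z - p) + p) <= M.
    apply: le_trans (cabsD _ _) _.
    have : A ^+ n * (cabs z + cabs p) <= A * (cabs z + cabs p).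
      by rewrite ler_wpM2r.
    have : A * cabs p <= cabs p by rewrite ler_piMl// ltW.
    rewrite /M; lra.
  apply: le_trans (CP f M _ _ ff wM pM) _.
  rewrite addrK (_ : M + 2 = A * cabs z + B); last by rewrite /M /B; ring.
  rewrite mulrAC ler_wpM2r ?expR_ge0// -[leRHS]mulrA ler_wpM2l//.
  by rewrite mulr_ge0 ?fock_norm_ge0.
split=> [n n0 f ff|eps eps0].
  (* Taking [q = cabs p + 1] makes the linear factor at least 1, so that it also dominates the
     constant [f p]. *)
  have [G _ GP] := fock_gaussian_bound hnu B A01 (addr_ge0 p0 ler01).
  split; first by apply: entireI; case: ff.
  pose m := cabs (f p) + C * fock_norm nu f.
  have m0 : 0 <= m by rewrite addr_ge0 ?cabs_ge0// mulr_ge0// fock_norm_ge0.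
  apply: le_lt_trans (GP _ m _ m0 _) (ltry _).
    by apply: entireI; case: ff.
  move=> z; have CN0 : 0 <= C * fock_norm nu f by rewrite mulr_ge0 ?fock_norm_ge0.
  set E := expR _; have E1 : 1 <= E.
    by apply: le_trans (expR_ge1Dx _); rewrite lerDl divr_ge0// sqr_ge0.
  have E0 : 0 <= E by exact: le_trans E1.
  have q1 : 1 <= cabs z + (cabs p + 1).
    by rewrite addrA lerDr addr_ge0 ?cabs_ge0.
  rewrite -(subrK (f p) (comp_op_iter phi n f z)).
  apply: le_trans (cabsD _ _) _; rewrite /m addrC 2!mulrDl; apply: lerD.
    by rewrite -mulrA ler_peMr ?cabs_ge0// mulr_ege1.
  apply: le_trans (lip n f z n0 ff) _; rewrite -/E ler_wpM2r//.
  apply: ler_pM; rewrite ?addr_ge0 ?cabs_ge0//.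
  - by rewrite mulr_ge0 ?exprn_ge0.
  - by rewrite ler_piMr// exprn_ile1// ltW.
  - by rewrite addrA lerDl.
have [G G0 GP] := fock_gaussian_bound hnu B A01 p0.
(* The operator norm of the [n]-th iterate minus [P] is at most [D * A ^+ n]; [D + 1] serves as a
   positive divisor. *)
pose D := C * (nu / (2 * pi) * G) `^ nu^-1.
have D0 : 0 <= D by rewrite mulr_ge0 ?powR_ge0.
have D1 : 0 < D + 1 by rewrite ltr_wpDl.
have : (GRing.exp A : R^nat) @ \oo --> (0 : R).
  by apply: cvg_expr; rewrite ger0_norm.
move=> /cvgrPdist_lt /(_ (eps / (D + 1)) (divr_gt0 eps0 D1)) [N _ NP].
exists N => n Nn f ff; have [ef _] := ff.
have N0 := fock_norm_ge0 nu f.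
have An0 : 0 <= A ^+ n.+1 by rewrite exprn_ge0.
pose m := C * fock_norm nu f * A ^+ n.+1.
have m0 : 0 <= m by rewrite !mulr_ge0.
have hm := GP (fun z => comp_op_iter phi n.+1 f z - P f z) m
  (entire_comp (entire_shift (- f p)) (entireI n.+1 f ef)) m0
  (fun z => lip n.+1 f z (ltn0Sn n) ff).
apply: le_trans (fock_norm_bound hnu m0 G0 hm) _.
have -> : m * (nu / (2 * pi) * G) `^ nu^-1 = D * A ^+ n.+1 * fock_norm nu f.
  by rewrite /m /D; ring.
rewrite ler_wpM2r//.
have := NP n.+1 (leqW Nn); rewrite /= sub0r normrN ger0_norm// => An.
apply: (@le_trans _ _ ((D + 1) * A ^+ n.+1)); first by rewrite ler_wpM2r// lerDl.
by rewrite mulrC -ler_pdivlMr// ltW.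
Qed.
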